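(* Consider the PPO-Clip algorithm with reverse KL regularization, initialized at any finite $\theta_{1,1}\in\mathbb{R}^{|\mathcal S||\mathcal A|}$, with nonnegative stepsizes such that $S:=\sum_{k=1}^K\eta_{n,k}$ is the same for every $n$. There exists a constant $\bar S_R>0$, depending only on the problem and algorithm parameters ($\mathcal S,\mathcal A,\mathcal P,r,\gamma,r_{\max},\lambda,\pi_{\mathrm{ref}},u,\varepsilon_l,\varepsilon_h,K$), such that if $S\in(0,\bar S_R]$, then the following hold. (i) $\inf_{n,k,s,a}\pi_{n,k}(a|s)\ge c_{\min}(S)>0$. (ii) With $\beta:=(1-\gamma)\lambda c_uc_{\min}(S)^2\,\big\|\frac{d_u^{\pi^*}}{u}\big\|_\infty^{-1}$, for every initial distribution $\rho$ and every $n\ge1$, $$\tilde V_\lambda^{\pi^*}(\rho)-\tilde V_\lambda^{\pi_{n,1}}(\rho)\le\frac{\tilde V_\lambda^{\pi^*}(u)-\tilde V_\lambda^{\pi_{1,1}}(u)}{c_u(1-\gamma)}e^{-\beta S(n-1)}.$$ (iii) For every $n\ge1$, $$\sum_s\|\pi_{n,1}(s)-\pi^*(s)\|_2^2\le\frac{2\big(\tilde V_\lambda^{\pi^*}(u)-\tilde V_\lambda^{\pi_{1,1}}(u)\big)}{\lambda c_u}e^{-\beta S(n-1)}.$$ Hence $\pi_{n,1}$ converges linearly to the unique optimal policy $\pi^*$.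
   Context: Setting. $(\mathcal S,\mathcal A,\mathcal P,r,\gamma)$ is a discounted Markov decision process with finite state and action sets, transition probabilities $\mathcal P(s'|s,a)$, reward $r:\mathcal S\times\mathcal A\to[0,r_{\max}]$, discount $\gamma\in[0,1)$. For $\theta\in\mathbb{R}^{|\mathcal S||\mathcal A|}$, $\pi_\theta(a|s)=\exp(\theta_{sa})/\sum_{a'}\exp(\theta_{sa'})$ (softmax); $\pi(s)$ denotes $\pi(\cdot|s)$. $\pi_{\mathrm{ref}}$ is a fixed reference policy with $c_{\pi_{\mathrm{ref}}}:=\min_{s,a}\pi_{\mathrm{ref}}(a|s)>0$; $L_{\mathrm{ref}}:=\max_{s,a}|\log\pi_{\mathrm{ref}}(a|s)|$; $\lambda>0$; $u$ is a state distribution with $u(s)\ge c_u>0$ for all $s$. The reverse KL regularizer is $D(\pi(s)):=\sum_a\pi(a|s)\log\frac{\pi(a|s)}{\pi_{\mathrm{ref}}(a|s)}$ ($0\log0=0$). Values. $\tilde V_\lambda^\pi(\rho)=\mathbb{E}[\sum_{t\ge0}\gamma^t(r(s_t,a_t)-\lambda D(\pi(s_t)))]$ with $s_0\sim\rho$, $a_t\sim\pi(\cdot|s_t)$, $s_{t+1}\sim\mathcal P(\cdot|s_t,a_t)$; $\tilde V_\lambda^\pi(s)$ is the value from $s_0=s$. $\tilde Q_\lambda^\pi(s,a)=r(s,a)-\lambda D(\pi(s))+\gamma\sum_{s'}\mathcal P(s'|s,a)\tilde V_\lambda^\pi(s')$ and $\tilde A_\lambda^\pi(s,a)=\tilde Q_\lambda^\pi(s,a)-\tilde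 V_\lambda^\pi(s)$. $\pi^*$ is the optimal policy, i.e. maximizing $\tilde V_\lambda^\pi(s)$ from every state $s$. $d_\rho^\pi(s)=(1-\gamma)\sum_{t\ge0}\gamma^t\Pr(s_t=s|s_0\sim\rho,\pi)$; $\|d/u\|_\infty=\max_sd(s)/u(s)$. Algorithm. For $n=1,2,\dots$ (outer loop) and $k=1,\dots,K$ (inner loop): $\theta_{n,k+1}=\theta_{n,k}+\eta_{n,k}g_{n,k}$ with $g_{n,k}=\nabla\mathcal L_n(\theta_{n,k})$; then $\theta_{n+1,1}=\theta_{n,K+1}$. Write $\pi_{n,k}=\pi_{\theta_{n,k}}$. With $\mathbb{E}_{\pi_{n,1}}:=\frac1{1-\gamma}\mathbb{E}_{s\sim d_u^{\pi_{n,1}},a\sim\pi_{n,1}(s)}$, $r_\theta^n=\pi_\theta(a|s)/\pi_{n,1}(a|s)$, and $\mathrm{clip}(v;1-\varepsilon_l,1+\varepsilon_h)$ the projection of $v$ onto $[1-\varepsilon_l,1+\varepsilon_h]$, where $0<\varepsilon_l<1$, $\varepsilon_h>0$, $$\mathcal L_n(\theta)=\mathbb{E}_{\pi_{n,1}}\Big[\min\{r_\theta^n\tilde A_\lambda^{\pi_{n,1}},\ \mathrm{clip}(r_\theta^n;1-\varepsilon_l,1+\varepsilon_h)\tilde A_\lambda^{\pi_{n,1}}\}-\lambda r_\theta^n\log\frac{\pi_\theta(a|s)}{\pi_{\mathrm{ref}}(a|s)}\Big]$$ (all quantities evaluated at $(s,a)$). Gradient convention at kinks: the derivative of the min-term with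 respect to the ratio $r_\theta^n(s,a)$ is taken to be $\tilde A_\lambda^{\pi_{n,1}}(s,a)$ if ($\tilde A_\lambda^{\pi_{n,1}}(s,a)\ge0$ and $r_\theta^n\le1+\varepsilon_h$) or ($\tilde A_\lambda^{\pi_{n,1}}(s,a)<0$ and $r_\theta^n\ge1-\varepsilon_l$), and $0$ otherwise. Constants. $\tilde A^R_{\max}:=\frac{r_{\max}+\lambda L_{\mathrm{ref}}}{1-\gamma}$; $G_\infty:=\frac{2\tilde A^R_{\max}+\lambda(e^{-1}+2L_{\mathrm{ref}})}{1-\gamma}$; $\tau_R:=c_{\pi_{\mathrm{ref}}}\exp(-2\tilde A^R_{\max}/\lambda)$; $\hat\theta_{1,1}(s,a):=\theta_{1,1}(s,a)-\frac1{|\mathcal A|}\sum_b\theta_{1,1}(s,b)$; for $\bar\eta\ge0$, $\underline\theta(\bar\eta):=\min\{0,\ \min_{s,a}\hat\theta_{1,1}(s,a),\ \log(|\mathcal A|\tau_R)-\bar\eta G_\infty\}$ and $c_{\min}(\bar\eta):=\dfrac{1}{1+(|\mathcal A|-1)\exp(-|\mathcal A|\underline\theta(\bar\eta))}$. *)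

(* Defs.v *)
From mathcomp Require Import all_boot all_order all_algebra.
From mathcomp Require Import all_classical all_reals all_analysis.

Set Implicit Arguments.
Unset Strict Implicit.
Unset Printing Implicit Defensive.

Import Order.TTheory GRing.Theory Num.Theory.
Import numFieldNormedType.Exports.

Local Open Scope classical_set_scope.
Local Open Scope ring_scope.

Definition is_dist (R : realType) (T : finType) (p : T -> R) : Prop :=
  (forall x, 0 <= p x) /\ \sum_x p x = 1.

Definition is_policy (R : realType) (S A : finType) (pi : S -> A -> R) : Prop :=
  forall s, is_dist (pi s).

Record mdp (R : realType) (S A : finType) := MDP {
  trans : S -> A -> S -> R; (* [trans s a s'] is P(s' | s, a) *)
  reward : S -> A -> R;
  rmax : R;
  gamma : R;
  trans_dist : forall s a, is_dist (trans s a);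
  reward_bound : forall s a, 0 <= reward s a <= rmax;
  gamma_bound : 0 <= gamma < 1 }.

Section Values.
Variables (R : realType) (S A : finType) (M : mdp R S A).
Variables (lam : R) (piref : S -> A -> R).
Implicit Types (rho : S -> R) (pi : S -> A -> R).

(* Since [ln] vanishes on nonpositive reals, the convention 0 log 0 = 0 holds
   automatically. *)
Definition rkl pi (s : S) : R := \sum_a pi s a * ln (pi s a / piref s a).

(* Probability of a trajectory prefix (s_0, a_0), ..., (s_T, a_T). *)
Definition path_prob rho pi (T : nat) (tau : {ffun 'I_T.+1 -> S * A}) : R :=
  rho (tau ord0).1 * (\prod_(t < T.+1) pi (tau t).1 (tau t).2) *
  \prod_(t < T) trans M (tau (widen_ord (leqnSn T) t)).1
                        (tau (widen_ord (leqnSn T) t)).2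
                        (tau (lift ord0 t)).1.

Definition expect_path rho pi (T : nat) (F : {ffun 'I_T.+1 -> S * A} -> R) : R :=
  \sum_(tau : {ffun 'I_T.+1 -> S * A}) path_prob rho pi tau * F tau.

Definition state_prob rho pi (t : nat) (s : S) : R :=
  expect_path rho pi (T := t) (fun tau => ((tau ord_max).1 == s)%:R).

(* The infinite-horizon expectation is the limit of the expected truncated
   returns; for a policy the per-step terms are bounded and gamma < 1, so the
   limit exists and commutes with the expectation. *)
Definition value rho pi : R :=
  limn (fun T : nat => expect_path rho pi (T := T) (fun tau =>
    \sum_(t < T.+1) gamma M ^+ t *
      (reward M (tau t).1 (tau t).2 - lam * rkl pi (tau t).1))).

Definition dirac_dist (s : S) : S -> R := fun s' => (s' == s)%:R.

Definition state_value pi (s : S) : R := value (dirac_dist s) pi.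

Definition q_value pi (s : S) (a : A) : R :=
  reward M s a - lam * rkl pi s +
  gamma M * \sum_s' trans M s a s' * state_value pi s'.

Definition advantage pi (s : S) (a : A) : R := q_value pi s a - state_value pi s.

Definition is_optimal pi : Prop :=
  is_policy pi /\
  forall pi', is_policy pi' -> forall s, state_value pi' s <= state_value pi s.

Definition occupancy rho pi (s : S) : R :=
  (1 - gamma M) *
  limn (fun T : nat => \sum_(t < T) gamma M ^+ t * state_prob rho pi t s).

(* max_s d(s) / u(s), for nonnegative ratios *)
Definition ratio_norm (d u : S -> R) : R := \big[Num.max/0]_s (d s / u s).

End Values.

Section PPO.
Variables (R : realType) (S A : finType) (M : mdp R S A).
Variables (lam : R) (piref : S -> A -> R) (u : S -> R) (el eh : R).
Implicit Types (theta : S -> A -> R).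

Definition softmax theta (s : S) (a : A) : R :=
  expR (theta s a) / \sum_b expR (theta s b).

(* E_pi [f] = 1 / (1 - gamma) * E_(s ~ d_u^pi, a ~ pi(s)) [f s a] *)
Definition expect_occ (pi f : S -> A -> R) : R :=
  (1 - gamma M)^-1 * \sum_s occupancy M u pi s * \sum_a pi s a * f s a.

Definition clip (v : R) : R := Num.min (Num.max v (1 - el)) (1 + eh).

Definition clip_term (adv v : R) : R := Num.min (v * adv) (clip v * adv).

Definition prob_ratio (pi0 : S -> A -> R) theta (s : S) (a : A) : R :=
  softmax theta s a / pi0 s a.

Definition reg_term (pi0 : S -> A -> R) theta (s : S) (a : A) : R :=
  prob_ratio pi0 theta s a * ln (softmax theta s a / piref s a).

(* The surrogate L_n, with [pi0] the outer-loop policy pi_{n,1}. *)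
Definition surrogate (pi0 : S -> A -> R) theta : R :=
  expect_occ pi0 (fun s a =>
    clip_term (advantage M lam piref pi0 s a) (prob_ratio pi0 theta s a)
    - lam * reg_term pi0 theta s a).

Definition shift_coord theta (s : S) (a : A) (t : R) : S -> A -> R :=
  fun s' a' => theta s' a' + t * ((s' == s) && (a' == a))%:R.

Definition partial (f : (S -> A -> R) -> R) theta (s : S) (a : A) : R :=
  derive1 (fun t : R => f (shift_coord theta s a t)) 0.

(* Derivative of [clip_term adv] at [v], with the stated choice at kinks. *)
Definition clip_deriv (adv v : R) : R :=
  if (0 <= adv) && (v <= 1 + eh) || (adv < 0) && (1 - el <= v)
  then adv else 0.

(* Gradient of [surrogate pi0] by the chain rule through the ratio, where
   [clip_deriv] stands for the derivative of the min-term; away from the kinks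
   it is the actual gradient, see [partial_surrogate] below. *)
Definition surrogate_grad (pi0 : S -> A -> R) theta (s : S) (a : A) : R :=
  expect_occ pi0 (fun s' a' =>
    clip_deriv (advantage M lam piref pi0 s' a') (prob_ratio pi0 theta s' a') *
      partial (fun th => prob_ratio pi0 th s' a') theta s a
    - lam * partial (fun th => reg_term pi0 th s' a') theta s a).

(* [theta n k] is theta_{n,k}; both indices start at 1. *)
Definition ppo_run (K : nat) (theta11 : S -> A -> R) (eta : nat -> nat -> R)
    (theta : nat -> nat -> S -> A -> R) : Prop :=
  [/\ theta 1%N 1%N = theta11,
      forall n k, (1 <= n)%N -> (1 <= k <= K)%N -> forall s a,
        theta n k.+1 s a = theta n k s a +
          eta n k * surrogate_grad (softmax (theta n 1%N)) (theta n k) s a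
    & forall n, (1 <= n)%N -> theta n.+1 1%N = theta n K.+1].

End PPO.

Section GradientConvention.
Variables (R : realType) (S A : finType) (M : mdp R S A).
Variables (lam : R) (piref : S -> A -> R) (u : S -> R) (el eh : R).
Hypotheses (el_gt0 : 0 < el) (eh_gt0 : 0 < eh).
Hypothesis piref_gt0 : forall s a, 0 < piref s a.

Let is_derive_fin_sum (I : finType) (h : I -> R -> R) (dh : I -> R) (x : R) :
  (forall i, is_derive x 1 (h i) (dh i)) ->
  is_derive x 1 (fun t => \sum_i h i t) (\sum_i dh i).
Proof.
move=> H; rewrite -fct_sumE; elim/big_ind2 : _ => //.
  exact: is_derive_cst.
by move=> f df g dg Hf Hg; exact: is_deriveD.
Qed.

Lemma is_derive_clip_term (adv v : R) :
  (0 < adv -> v != 1 + eh) -> (adv < 0 -> v != 1 - el) ->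
  is_derive v 1 (clip_term el eh adv) (clip_deriv el eh adv v).
Proof.
move=> Hp Hn; rewrite /clip_deriv.
have Hb : 1 - el <= 1 + eh by rewrite lerD2l (le_trans _ (ltW eh_gt0))// oppr_le0 ltW.
have Hlin : is_derive v 1 (fun w : R => w * adv) adv.
  have := @is_deriveZ _ _ _ (id : R -> R) adv v 1 1 (is_derive_id _ _).
  rewrite scaler1; congr is_derive; apply/funext => w.
  by rewrite mulrC.
case: (ltgtP adv 0) => [a0|a0|->] /=.
- have [v1|v1] := leP (1 - el) v.
    have {}v1 : 1 - el < v by rewrite lt_neqAle eq_sym Hn.
    apply: near_eq_is_derive Hlin; near=> w.
    have v1' : 1 - el < w by near: w; exact: lt_nbhsr.
    rewrite /clip_term min_l// ler_nM2r// /clip ge_min.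
    by rewrite ge_max lexx (ltW v1').
  apply: near_eq_is_derive (is_derive_cst ((1 - el) * adv) v 1); near=> w.
  have v1' : w < 1 - el by near: w; exact: lt_nbhsl.
  rewrite /clip_term /clip /cst (max_r (ltW v1')) (min_l (x := 1 - el)).
    by rewrite min_r// ler_nM2r// ltW.
  exact: Hb.
- rewrite ?orbF; have [v1|v1] := leP v (1 + eh).
    have {}v1 : v < 1 + eh by rewrite lt_neqAle Hp.
    apply: near_eq_is_derive Hlin; near=> w.
    have v1' : w < 1 + eh by near: w; exact: lt_nbhsl.
    rewrite /clip_term min_l// ler_pM2r// /clip le_min.
    by rewrite le_max lexx (ltW v1').
  apply: near_eq_is_derive (is_derive_cst ((1 + eh) * adv) v 1); near=> w.
  have v1' : 1 + eh < w by near: w; exact: lt_nbhsr.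
  rewrite /clip_term /clip /cst (@max_l _ _ w); last exact: le_trans Hb (ltW v1').
  by rewrite (min_r (ltW v1')) min_r// ler_pM2r// ltW.
- rewrite ?if_same; apply: near_eq_is_derive (is_derive_cst 0 v 1).
  by near=> w; rewrite /clip_term !mulr0 minxx.
Unshelve. all: by end_near. Qed.

Let derivable_softmax (theta : S -> A -> R) (s s' : S) (a a' : A) :
  derivable (fun t : R => softmax (shift_coord theta s a t) s' a') 0 1.
Proof.
have Hc b : is_derive (0 : R) 1
    (fun t : R => shift_coord theta s a t s' b) ((s' == s) && (b == a))%:R.
  set c : R := _%:R.
  have := @is_deriveD _ _ _ _ _ _ _ _ _ (is_derive_cst (theta s' b) (0 : R) 1)
    (@is_deriveZ _ _ _ (id : R -> R) c 0 1 1 (is_derive_id _ _)).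
  rewrite add0r scaler1; congr is_derive; apply/funext => t.
  by rewrite /shift_coord mulrC.
have He b : is_derive (0 : R) 1
    (fun t : R => expR (shift_coord theta s a t s' b)) _ :=
  is_derive1_comp (is_derive_expR _) (Hc b).
have Hsum := is_derive_fin_sum He.
apply: derivableM; first by apply: ex_derive; exact: He.
apply: ex_derive; apply: is_deriveV Hsum.
rewrite gt_eqF// (bigD1 a')//= ltr_pwDl ?expR_gt0//.
by apply: sumr_ge0 => b _; exact: expR_ge0.
Qed.

Lemma partial_surrogate (pi0 theta : S -> A -> R) (s : S) (a : A) :
  (forall s' a', 0 < advantage M lam piref pi0 s' a' ->
     prob_ratio pi0 theta s' a' != 1 + eh) ->
  (forall s' a', advantage M lam piref pi0 s' a' < 0 ->
     prob_ratio pi0 theta s' a' != 1 - el) ->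
  partial (surrogate M lam piref u el eh pi0) theta s a =
  surrogate_grad M lam piref u el eh pi0 theta s a.
Proof.
move=> Hp Hn; rewrite /partial derive1E.
have sc0 : shift_coord theta s a 0 = theta.
  by apply/funext => x; apply/funext => y; rewrite /shift_coord mul0r addr0.
have sm_gt0 (th : S -> A -> R) x y : 0 < softmax th x y :> R.
  rewrite divr_gt0 ?expR_gt0// (bigD1 y)//= ltr_pwDl ?expR_gt0//.
  by apply: sumr_ge0 => b _; exact: expR_ge0.
have dr s' a' : derivable
    (fun t : R => prob_ratio pi0 (shift_coord theta s a t) s' a') 0 1.
  apply: derivableM; [exact: derivable_softmax | exact: derivable_cst].
have dl s' a' : derivable
    (fun t : R => reg_term piref pi0 (shift_coord theta s a t) s' a') 0 1.
  apply: derivableM => //; apply: ex_derive.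
  apply: (@is_derive1_comp _ (@ln R)); first apply: is_derive1_ln.
    by rewrite divr_gt0.
  apply: DeriveDef; last reflexivity.
  apply: derivableM; [exact: derivable_softmax | exact: derivable_cst].
have dZ (f : R -> R) (c df : R) :
    is_derive (0 : R) 1 f df -> is_derive (0 : R) 1 (fun t => c * f t) (c * df).
  exact: is_deriveZ.
apply: derive_val; rewrite /surrogate /surrogate_grad /expect_occ.
apply: (dZ); apply: is_derive_fin_sum => s'; apply: (dZ).
apply: is_derive_fin_sum => a'; apply: (dZ); apply: is_deriveB.
  apply: (@is_derive1_comp _ (clip_term el eh _)).
    by rewrite sc0; apply: is_derive_clip_term; [exact: Hp|exact: Hn].
  by rewrite /partial derive1E; exact: DeriveDef.
by apply: (dZ); rewrite /partial derive1E; exact: DeriveDef.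
Qed.

End GradientConvention.

Section Constants.
Variables (R : realType) (S A : finType) (M : mdp R S A).
Variables (lam : R) (piref : S -> A -> R).

(* For a policy all entries are at most 1, so the neutral element 1 is harmless;
   likewise 0 for the maximum of absolute values. *)
Definition c_ref : R := \big[Num.min/1]_(sa : S * A) piref sa.1 sa.2.
Definition L_ref : R := \big[Num.max/0]_(sa : S * A) `|ln (piref sa.1 sa.2)|.

Definition A_max : R := (rmax M + lam * L_ref) / (1 - gamma M).

Definition G_inf : R :=
  (2 * A_max + lam * (expR (-1) + 2 * L_ref)) / (1 - gamma M).

Definition tau_R : R := c_ref * expR (- (2 * A_max / lam)).

Definition centered (theta : S -> A -> R) (s : S) (a : A) : R :=
  theta s a - #|A|%:R^-1 * \sum_b theta s b.

(* The neutral element 0 of the iterated minimum is the 0 in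
   min {0, min_(s,a) centered, ...}. *)
Definition theta_low (theta11 : S -> A -> R) (etabar : R) : R :=
  Num.min (\big[Num.min/0]_(sa : S * A) centered theta11 sa.1 sa.2)
          (ln (#|A|%:R * tau_R) - etabar * G_inf).

Definition c_min (theta11 : S -> A -> R) (etabar : R) : R :=
  (1 + (#|A|%:R - 1) * expR (- (#|A|%:R * theta_low theta11 etabar)))^-1.

End Constants.

Definition sqdist (R : realType) (S A : finType) (pi pi' : S -> A -> R) : R :=
  \sum_s \sum_a (pi s a - pi' s a) ^+ 2.

Definition converges_linearly (R : realType) (S A : finType)
    (pi : nat -> S -> A -> R) (pi' : S -> A -> R) : Prop :=
  exists C q : R, [/\ 0 <= C, 0 <= q < 1 &
    forall n, Num.sqrt (sqdist (pi n) pi') <= C * q ^+ n].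

(* Main.v *)
Require Import Defs.
From mathcomp Require Import all_boot all_order all_algebra.
From mathcomp Require Import all_classical all_reals all_analysis.
From mathcomp Require Import ring lra.
Import Order.TTheory GRing.Theory Num.Theory.
Import numFieldNormedType.Exports.
Set Implicit Arguments.
Unset Strict Implicit.
Unset Printing Implicit Defensive.
Local Open Scope classical_set_scope.
Local Open Scope ring_scope.

(** The optimal policy is the Gibbs tilt of [piref] by the fixed point of the soft
    Bellman operator. For it the performance difference lemma becomes an identity:
    [1 - gamma] times the suboptimality of a policy is [lam] times its
    occupancy-weighted Kullback-Leibler divergence to the optimal policy
    ([soft_optimal_exists]). This gives optimality, uniqueness, and, as the
    divergence is at least half of the squared Euclidean distance
    ([kl_ge_sqdist]), the passage from value gaps to distances of policies.

    The surrogate gradient decouples over the states: at [s] it is the occupancy of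
    [s] over [1 - gamma] times the gradient, in the logits, of the regularized
    linear objective [sum_a p a * adv a - lam * kl p (piref s)], with advantages set
    to zero where clipping is active ([surrogate_gradE]). An action of probability
    at most [tau_R] has a nonnegative gradient, and no gradient entry exceeds
    [G_inf] in absolute value; since the mean logit of a state is invariant, the centered logits stay
    above [theta_low], which bounds all probabilities below by [c_min]
    ([centered_ge_low], [run_ge_cmin]).

    The logit gradient is bounded and Lipschitz with constants that do not depend on
    the iterate, because moving the logits by at most [e] multiplies every
    probability by a factor between [exp (- 2 e)] and [exp (2 e)] and [p * ln p] is bounded. Hence, if
    the total stepsize is small, no ratio leaves the clipping range during an inner
    loop, and the loop increases the objective at each state by at least half of the
    effective stepsize times the squared initial gradient ([inner_loop_gain]). In
    particular the increase is nonnegative at each state, so the performance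
    difference lemma can be applied with the occupancy of the new policy merely
    bounded below by [(1 - gamma) * u]. In the other direction the regularized
    objective is strongly concave in the policy, so the gain of any policy, the
    optimal one included, is at most the squared regularized advantage over
    [2 * lam] ([reg_gain_le]). Comparing the two estimates shows that each outer
    iteration multiplies the gap at [u] by at most [1 - beta * Ssum] ([gap_step]). *)

(** * Scalar inequalities for the exponential and the logarithm *)

Section Scalar.
Variable R : realType.
Implicit Types x p q d : R.

Lemma ln_le_sub1 x : 0 < x -> ln x <= x - 1.
Proof.
move=> x0; have := @le_ln1Dx R (x - 1).
by rewrite addrCA subrr addr0; apply; rewrite ltrBrDr addNr.
Qed.

Lemma ln_ratio p q : 0 < p -> 0 < q -> ln (p / q) = ln p - ln q.
Proof. by move=> p0 q0; rewrite ln_div ?posrE. Qed.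

Lemma expR_quad d : `|d| <= 1 / 2 -> 0 <= expR d - 1 - d <= 2 * d ^+ 2.
Proof.
rewrite ler_norml => /andP[d1 d2]; apply/andP; split.
  by have h := expR_ge1Dx d; lra.
have h1 : 0 < expR d by exact: expR_gt0.
have h2 : expR d * (1 - d) <= 1.
  have := expR_ge1Dx (- d); rewrite expRN => h3.
  by rewrite -ler_pdivlMl// mulr1.
by nra.
Qed.

Lemma expR_sub1_bound d : `|d| <= 1 / 2 -> `|expR d - 1| <= 2 * `|d|.
Proof.
move=> d1; have /andP[h1 h2] := expR_quad d1.
have -> : expR d - 1 = (expR d - 1 - d) + d by ring.
rewrite (le_trans (ler_normD _ _))// (ger0_norm h1).
have h3 : d ^+ 2 = `|d| ^+ 2 by rewrite real_normK// num_real.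
by have h4 := normr_ge0 d; nra.
Qed.

Lemma entropy_term_bound p : 0 < p <= 1 -> `|p * ln p| <= expR (-1).
Proof.
move=> /andP[p0 p1]; rewrite ler0_norm; last first.
  by rewrite mulr_ge0_le0// ?ln_le0// ltW.
have e0 : 0 < expR (-1 : R) by exact: expR_gt0.
have := @ln_le_sub1 (expR (-1) / p); rewrite divr_gt0// => /(_ isT).
rewrite ln_div ?posrE// expRK => h.
have : p * (-1 - ln p) <= p * (expR (-1) / p - 1) by rewrite ler_pM2l.
rewrite mulrBr mulrBr mulrCA divff ?gt_eqF// => h'; lra.
Qed.

(** Coordinatewise strong convexity of the Kullback-Leibler divergence on
    probabilities: the Bregman divergence of [x ln x] has modulus 1 on the unit
    interval, because the second derivative [1 / x] is at least 1 there. *)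
Lemma kl_term_ge p q : 0 <= p <= 1 -> 0 < q <= 1 ->
  (p - q) ^+ 2 / 2 <= p * ln (p / q) - p + q.
Proof.
move=> /andP[p0 p1] /andP[q0 q1].
have [p0'|] := ltP 0 p; last first.
  move=> pn; have -> : p = 0 by apply/eqP; rewrite eq_le pn p0.
  by rewrite mul0r; nra.
pose f x : R := x * ln x - x * ln q - x + q - (x - q) ^+ 2 / 2.
pose df x : R := ln x - ln q - (x - q).
have fd x : 0 < x -> is_derive x 1 f (df x).
  move=> x0; have hl := is_derive1_ln x0.
  rewrite /f; apply: is_derive_eq.
  rewrite /GRing.scale /= /df; field; lra.
have fc a b : 0 < a -> {within `[a, b], continuous f}.
  move=> a0; apply: derivable_within_continuous => x.
  rewrite in_itv /= => /andP[ax _]; have := fd x (lt_le_trans a0 ax).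
  by move=> h; exact: ex_derive.
have fq : f q = 0 by rewrite /f; ring.
suff : 0 <= f p by rewrite /f ln_div ?posrE//; lra.
have [qp|pq] := leP q p.
- have fd' x : x \in `]q, p[ -> is_derive x 1 f (df x).
    rewrite in_itv /= => /andP[qx _]; apply: fd; exact: lt_trans qx.
  have [c] := MVT_segment qp fd' (fc q p q0).
  rewrite in_itv /= fq subr0 => /andP[qc cp] ->.
  have c0 : 0 < c by exact: lt_le_trans qc.
  rewrite mulr_ge0 ?subr_ge0//.
  have := @ln_le_sub1 (q / c); rewrite divr_gt0// ln_div ?posrE// => /(_ isT) h.
  have h1 : (q / c) * c = q by rewrite divfK// gt_eqF.
  have h2 : q / c <= 1 by rewrite ler_pdivrMr// mul1r.
  have : 0 <= (1 - q / c) * (1 - c).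
    by rewrite mulr_ge0 ?subr_ge0// (le_trans cp).
  rewrite /df mulrBl mulrBr mulrBr h1 => h3; lra.
- have fd' x : x \in `]p, q[ -> is_derive x 1 f (df x).
    rewrite in_itv /= => /andP[qx _]; apply: fd; exact: lt_trans qx.
  have [c] := MVT_segment (ltW pq) fd' (fc p q p0').
  rewrite in_itv /= fq sub0r => /andP[pc cq] h0.
  have c0 : 0 < c by exact: lt_le_trans pc.
  suff : df c <= 0 by nra.
  have := @ln_le_sub1 (c / q); rewrite divr_gt0// ln_div ?posrE// => /(_ isT) h.
  have h1 : (c / q) * q = c by rewrite divfK// gt_eqF.
  have h2 : c / q <= 1 by rewrite ler_pdivrMr// mul1r.
  have : 0 <= (1 - c / q) * (1 - q) by rewrite mulr_ge0 ?subr_ge0.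
  rewrite /df mulrBl mulrBr mulrBr h1 => h3; lra.
Qed.

End Scalar.

(** * Discounted Markov chains on a finite state space *)

(** Existence of the fixed point of a contraction for the maximum norm, on functions
    over a finite set. *)
Lemma sup_contraction_fixpoint (R : realType) (S : finType) (g : R)
    (T : (S -> R) -> S -> R) : 0 <= g < 1 ->
  (forall x y c, (forall s, `|x s - y s| <= c) ->
     forall s, `|T x s - T y s| <= g * c) ->
  exists x, forall s, T x s = x s.
Proof.
move=> /andP[g0 g1] HT.
pose x_ n := iter n T (fun=> 0).
pose C := \sum_s `|T (fun=> 0) s|.
have stepC n s : `|x_ n.+1 s - x_ n s| <= C * g ^+ n.
  elim: n s => [|n IH] s; last by rewrite exprS mulrCA; exact: HT.
  by rewrite /x_ /= subr0 expr0 mulr1 /C (bigD1 s)//= lerDl sumr_ge0.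
have cv s : cvgn (fun n => x_ n s).
  have -> : (fun n => x_ n s) = series (fun n => x_ n.+1 s - x_ n s).
    by apply/funext => n; rewrite /series /= telescope_sumr// [X in _ - X]/= subr0.
  apply: normed_cvg; apply: (@series_le_cvg _ _ (geometric C g)).
  - by move=> n; exact: normr_ge0.
  - by move=> n; rewrite /geometric /= mulr_ge0 ?exprn_ge0// sumr_ge0.
  - by move=> n; exact: stepC.
  - by apply: is_cvg_geometric_series; rewrite ger0_norm.
pose L s := limn (fun n => x_ n s).
have cvL s : (fun n => x_ n s) @ \oo --> L s by exact: cv.
exists L => s.
have c1 : (fun n => x_ n.+1 s) @ \oo --> L s.
  by rewrite (cvg_shiftS (fun n => x_ n s)).
have c2 : (fun n => x_ n.+1 s) @ \oo --> T L s.
  apply/cvgrPdist_le => e e0.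
  have : \forall n \near \oo, forall s', `|L s' - x_ n s'| <= e.
    by apply: filter_forall => s'; move/cvgrPdist_le : (cvL s'); exact.
  apply: filterS => n h.
  by apply: (le_trans (HT _ _ _ h s)); rewrite ger_pMl// ltW.
exact: (cvg_unique _ c2 c1).
Qed.

Lemma dist_inhabited (R : realType) (T : finType) (p : T -> R) :
  is_dist p -> exists x : T, True.
Proof.
move=> [_ p1]; apply: contrapT => na; move: p1.
rewrite big1 => [/esym/eqP|a]; first by rewrite oner_eq0.
by exfalso; apply: na; exists a.
Qed.

(** State distribution at time [t] of the chain with kernel [P] started from
    [rho]. *)
Definition chain_law (R : realType) (S : finType) (P : S -> S -> R)
    (rho : S -> R) (t : nat) : S -> R :=
  iter t (fun mu s' => \sum_s mu s * P s s') rho.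

Section DiscountedChain.
Variables (R : realType) (S : finType) (P : S -> S -> R) (g : R).
Hypothesis P_dist : forall s, is_dist (P s).
Hypothesis g_bound : 0 <= g < 1.
Implicit Types (rho x b : S -> R).

Lemma chain_law_dist rho t : is_dist rho -> is_dist (chain_law P rho t).
Proof.
move=> Hr; elim: t => [//|t [IH0 IH1]]; split => [s'|]; rewrite /=.
  by apply: sumr_ge0 => s _; rewrite mulr_ge0//; case: (P_dist s).
rewrite exchange_big/= -[RHS]IH1; apply: eq_bigr => s _.
by rewrite -mulr_sumr (proj2 (P_dist s)) mulr1.
Qed.

Lemma dist_le1 (I : finType) (p : I -> R) i : is_dist p -> p i <= 1.
Proof. by move=> [p0 <-]; rewrite (bigD1 i)//= lerDl sumr_ge0. Qed.

Lemma dist_mean_bound (I : finType) (p : I -> R) (f : I -> R) c : is_dist p ->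
  (forall i, `|f i| <= c) -> `|\sum_i p i * f i| <= c.
Proof.
move=> [p0 p1] fc; rewrite (le_trans (ler_norm_sum _ _ _))//.
rewrite -[leRHS]mul1r -p1 mulr_suml; apply: ler_sum => i _.
by rewrite normrM ger0_norm// ler_wpM2l.
Qed.

Lemma resolvent_exists b :
  exists x, forall s, x s = b s + g * \sum_s' P s s' * x s'.
Proof.
have [|x Hx] := @sup_contraction_fixpoint R S g
    (fun x s => b s + g * \sum_s' P s s' * x s') g_bound.
  move=> x y c Hxy s; rewrite opprD addrACA subrr add0r -mulrBr -sumrB.
  case/andP: g_bound => g0 _.
  rewrite normrM ger0_norm// ler_wpM2l//.
  under eq_bigr do rewrite -mulrBr.
  exact: (dist_mean_bound (P_dist s)).
by exists x => s; rewrite -[LHS]Hx.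
Qed.

Lemma chain_law_succ_mean rho t x :
  \sum_s chain_law P rho t.+1 s * x s =
  \sum_s chain_law P rho t s * \sum_s' P s s' * x s'.
Proof.
rewrite /=; under eq_bigr do rewrite mulr_suml.
rewrite exchange_big; apply: eq_bigr => s _.
by rewrite mulr_sumr; apply: eq_bigr => s' _; rewrite mulrA.
Qed.

(** The discounted sum of [x - g P x] telescopes. *)
Lemma discounted_sum_cvg rho x b : is_dist rho ->
  (forall s, x s = b s + g * \sum_s' P s s' * x s') ->
  (fun T : nat => \sum_(t < T) g ^+ t * \sum_s chain_law P rho t s * b s) @ \oo
    --> \sum_s rho s * x s.
Proof.
move=> Hr Hx; case/andP: (g_bound) => g0 g1.
have -> : (fun T : nat => \sum_(t < T) g ^+ t * \sum_s chain_law P rho t s * b s)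
   = (fun T : nat => \sum_s rho s * x s -
       g ^+ T * \sum_s chain_law P rho T s * x s).
  apply/funext; elim=> [|T IH]; first by rewrite big_ord0 expr0 mul1r subrr.
  rewrite big_ord_recr /= IH chain_law_succ_mean exprSr.
  have -> : \sum_s chain_law P rho T s * x s = \sum_s chain_law P rho T s * b s +
      g * \sum_s chain_law P rho T s * \sum_s' P s s' * x s'.
    rewrite mulr_sumr -big_split /=; apply: eq_bigr => s _.
    by rewrite [in LHS]Hx; ring.
  ring.
rewrite -[X in _ --> X]subr0; apply: cvgB; first exact: cvg_cst.
pose C := \sum_s `|x s|.
have xC s : `|x s| <= C by rewrite /C (bigD1 s)//= lerDl sumr_ge0.
apply/norm_cvg0P; apply: (@squeeze_cvgr _ _ _ _ (fun=> 0) (geometric C g)).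
- near=> T; rewrite normr_ge0 /=.
  rewrite normrM ger0_norm ?exprn_ge0// mulrC ler_wpM2r ?exprn_ge0//.
  exact/dist_mean_bound/xC/chain_law_dist.
- exact: cvg_cst.
- by apply: cvg_geometric; rewrite ger0_norm.
Unshelve. all: by end_near. Qed.

(** Discounted occupancy measure, normalized to total mass 1. *)
Definition chain_occ rho s : R := (1 - g) *
  limn (fun T : nat => \sum_(t < T) g ^+ t * chain_law P rho t s).

Let indic_sum (p : S -> R) s : \sum_s' p s' * (s' == s)%:R = p s.
Proof.
rewrite (bigD1 s)//= eqxx mulr1 big1 ?addr0// => s' /negPf ->.
by rewrite mulr0.
Qed.

Lemma chain_occ_cvg rho s : is_dist rho ->
  cvgn (fun T : nat => \sum_(t < T) g ^+ t * chain_law P rho t s).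
Proof.
move=> Hr; have [x Hx] := resolvent_exists (fun s' => (s' == s)%:R).
apply: (cvgP (\sum_s rho s * x s)).
suff -> : (fun T : nat => \sum_(t < T) g ^+ t * chain_law P rho t s) =
    (fun T : nat => \sum_(t < T) g ^+ t *
       \sum_s' chain_law P rho t s' * (s' == s)%:R).
  exact: discounted_sum_cvg Hr Hx.
by apply/funext => T; apply: eq_bigr => t _; rewrite indic_sum.
Qed.

(** The occupancy measure represents the resolvent of the kernel. *)
Lemma chain_occ_resolvent rho x : is_dist rho ->
  \sum_s chain_occ rho s * (x s - g * \sum_s' P s s' * x s') =
  (1 - g) * \sum_s rho s * x s.
Proof.
move=> Hr; rewrite /chain_occ.
pose b s := x s - g * \sum_s' P s s' * x s'.
under eq_bigr do rewrite -mulrA; rewrite -mulr_sumr; congr (_ * _).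
have h1 : (fun T : nat => \sum_s (\sum_(t < T) g ^+ t * chain_law P rho t s) * b s)
    @ \oo --> \sum_s limn (fun T : nat => \sum_(t < T) g ^+ t * chain_law P rho t s) * b s.
  apply: cvg_big => [|s _]; first exact: add_continuous.
  by apply: cvgMr_tmp; exact: chain_occ_cvg.
have h2 : (fun T : nat => \sum_s (\sum_(t < T) g ^+ t * chain_law P rho t s) * b s)
    @ \oo --> \sum_s rho s * x s.
  have -> : (fun T : nat => \sum_s (\sum_(t < T) g ^+ t * chain_law P rho t s) * b s)
    = (fun T : nat => \sum_(t < T) g ^+ t * \sum_s chain_law P rho t s * b s).
    apply/funext => T; under eq_bigr do rewrite mulr_suml.
    rewrite exchange_big; apply: eq_bigr => t _; rewrite mulr_sumr.
    by apply: eq_bigr => s _; rewrite mulrA.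
  by apply: discounted_sum_cvg => // s; rewrite /b subrK.
exact: (cvg_unique _ h1 h2).
Qed.

Lemma chain_occ_ge0 rho s : is_dist rho -> 0 <= chain_occ rho s.
Proof.
move=> Hr; case/andP: (g_bound) => g0 g1.
rewrite mulr_ge0//; first by rewrite subr_ge0 ltW.
apply: limr_ge; first exact: chain_occ_cvg.
near=> T; apply: sumr_ge0 => t _; rewrite mulr_ge0 ?exprn_ge0//.
by case: (chain_law_dist t Hr).
Unshelve. all: by end_near. Qed.

Lemma chain_occ_ge rho s : is_dist rho -> (1 - g) * rho s <= chain_occ rho s.
Proof.
move=> Hr; case/andP: (g_bound) => g0 g1.
have := chain_occ_resolvent (fun s' => (s' == s)%:R) Hr.
rewrite indic_sum => <-; under eq_bigr do rewrite mulrBr.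
rewrite sumrB indic_sum lerBlDr lerDl; apply: sumr_ge0 => s' _.
by rewrite indic_sum mulr_ge0 ?chain_occ_ge0// mulr_ge0//; case: (P_dist s').
Qed.

Lemma chain_occ_dist rho : is_dist rho -> is_dist (chain_occ rho).
Proof.
move=> Hr; split=> [s|]; first exact: chain_occ_ge0.
case/andP: (g_bound) => g0 g1.
have g1' : 1 - g != 0 by rewrite subr_eq0 gt_eqF.
have /= := chain_occ_resolvent (fun=> 1) Hr.
under eq_bigr => s _.
  under eq_bigr do rewrite mulr1; rewrite (proj2 (P_dist s)) mulr1; over.
rewrite -mulr_suml.
under [in RHS]eq_bigr do rewrite mulr1.
rewrite (proj2 Hr) mulrC => h; exact: (mulfI g1').
Qed.

End DiscountedChain.

(** * Trajectory expectations, values and occupancy measures *)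

(** Append one more state-action pair to a trajectory. *)
Definition ext_path (X : finType) (T : nat) (p : {ffun 'I_T.+1 -> X} * X) :
    {ffun 'I_T.+2 -> X} :=
  [ffun i => if unlift ord_max i is Some j then p.1 j else p.2].

Lemma ext_path_last (X : finType) T (p : {ffun 'I_T.+1 -> X} * X) :
  ext_path p ord_max = p.2.
Proof. by rewrite ffunE unlift_none. Qed.

Lemma ext_path_widen (X : finType) T (p : {ffun 'I_T.+1 -> X} * X) j :
  ext_path p (widen_ord (leqnSn T.+1) j) = p.1 j.
Proof.
rewrite ffunE; have -> : widen_ord (leqnSn T.+1) j = lift ord_max j.
  by apply: val_inj; rewrite /= /bump leqNgt ltn_ord.
by rewrite liftK.
Qed.

Lemma ext_path_bij (X : finType) T : bijective (@ext_path X T).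
Proof.
exists (fun tau : {ffun 'I_T.+2 -> X} =>
  ([ffun j => tau (widen_ord (leqnSn T.+1) j)], tau ord_max)).
  move=> [tau x]; rewrite ext_path_last; congr (_, _); apply/ffunP => j.
  by rewrite ffunE ext_path_widen.
move=> tau; apply/ffunP => i; case: (unliftP ord_max i) => [j ->|->].
  have -> : lift ord_max j = widen_ord (leqnSn T.+1) j.
    by apply: val_inj; rewrite /= /bump leqNgt ltn_ord.
  by rewrite ext_path_widen ffunE.
by rewrite ext_path_last.
Qed.

Lemma big_ffun1 (R : nmodType) (X : finType) (F : {ffun 'I_1 -> X} -> R) :
  \sum_tau F tau = \sum_x F [ffun=> x].
Proof.
rewrite (reindex (fun x : X => [ffun=> x] : {ffun 'I_1 -> X}))//.
exists (fun tau : {ffun 'I_1 -> X} => tau ord0) => [x _|tau _]; first by rewrite ffunE.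
by apply/ffunP => i; rewrite ffunE (ord1 i).
Qed.

(** State-to-state transition kernel of the chain that follows a policy. *)
Definition policy_kernel (R : realType) (S A : finType) (M : mdp R S A)
  (pi : S -> A -> R) (s s' : S) : R := \sum_a pi s a * trans M s a s'.

Section Paths.
Variables (R : realType) (S A : finType) (M : mdp R S A).
Variables (rho : S -> R) (pi : S -> A -> R).
Hypotheses (rho_dist : is_dist rho) (pi_pol : is_policy pi).

Let P := policy_kernel M pi.

Lemma policy_kernel_dist s : is_dist (P s).
Proof.
split=> [s'|].
  apply: sumr_ge0 => a _; rewrite mulr_ge0//; first by case: (pi_pol s).
  by case: (trans_dist M s a).
rewrite exchange_big -[RHS](proj2 (pi_pol s)); apply: eq_bigr => a _.
by rewrite -mulr_sumr (proj2 (trans_dist M s a)) mulr1.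
Qed.

Lemma path_prob_ext T (tau : {ffun 'I_T.+1 -> S * A}) x :
  path_prob M rho pi (ext_path (tau, x)) =
  path_prob M rho pi tau *
    (trans M (tau ord_max).1 (tau ord_max).2 x.1 * pi x.1 x.2).
Proof.
have e0 : ext_path (tau, x) ord0 = tau ord0.
  have -> : ord0 = widen_ord (leqnSn T.+1) ord0 :> 'I_T.+2 by exact: val_inj.
  by rewrite ext_path_widen.
rewrite /path_prob e0 big_ord_recr /= ext_path_last /=.
under eq_bigr do rewrite ext_path_widen /=.
rewrite [X in _ * _ * X]big_ord_recr /=.
have -> : lift ord0 ord_max = ord_max :> 'I_T.+2 by exact: val_inj.
rewrite !ext_path_widen ext_path_last /=.
under [X in _ * _ * (X * _)]eq_bigr => t _.
  have -> : lift ord0 (widen_ord (leqnSn T) t) =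
     widen_ord (leqnSn T.+1) (lift ord0 t) by exact: val_inj.
  rewrite !ext_path_widen /=; over.
ring.
Qed.

Lemma expect_path_succ T (F : {ffun 'I_T.+2 -> S * A} -> R) :
  expect_path M rho pi F = expect_path M rho pi (fun tau =>
    \sum_(x : S * A) trans M (tau ord_max).1 (tau ord_max).2 x.1 * pi x.1 x.2 *
       F (ext_path (tau, x))).
Proof.
rewrite /expect_path (reindex (@ext_path _ T)) /=; last first.
  exact: onW_bij (@ext_path_bij _ _).
rewrite (eq_bigr (fun p => (fun tau x => path_prob M rho pi (ext_path (tau, x)) *
   F (ext_path (tau, x))) p.1 p.2)); last by case.
rewrite -(pair_bigA _ (fun tau x => path_prob M rho pi (ext_path (tau, x)) *
   F (ext_path (tau, x)))) /=.
apply: eq_bigr => tau _; rewrite mulr_sumr; apply: eq_bigr => x _.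
by rewrite path_prob_ext !mulrA.
Qed.

(** The last pair of a trajectory has the law of the chain, with the action drawn
    from the policy. *)
Lemma expect_path_last T (f : S -> A -> R) :
  expect_path M rho pi (T := T) (fun tau => f (tau ord_max).1 (tau ord_max).2) =
  \sum_s chain_law P rho T s * \sum_a pi s a * f s a.
Proof.
elim: T f => [|T IH] f.
  rewrite /expect_path big_ffun1 /=.
  rewrite (eq_bigr (fun x : S * A => (fun s a => rho s * (pi s a * f s a)) x.1 x.2)).
    rewrite -(pair_bigA _ (fun s a => rho s * (pi s a * f s a))) /=.
    by apply: eq_bigr => s _; rewrite mulr_sumr.
  by move=> x _; rewrite /path_prob big_ord_recr !big_ord0 !ffunE /= mul1r mulr1 mulrA.
rewrite expect_path_succ.
pose h s a := \sum_(x : S * A) trans M s a x.1 * pi x.1 x.2 * f x.1 x.2.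
transitivity (expect_path M rho pi (T := T)
    (fun tau => h (tau ord_max).1 (tau ord_max).2)).
  apply: eq_bigr => tau _; congr (_ * _); apply: eq_bigr => x _.
  by rewrite ext_path_last.
rewrite IH /h.
rewrite chain_law_succ_mean; apply: eq_bigr => s _; congr (_ * _).
under [RHS]eq_bigr do rewrite mulr_suml.
rewrite exchange_big; apply: eq_bigr => a _ /=.
under [RHS]eq_bigr do rewrite -mulrA; rewrite -mulr_sumr; congr (_ * _).
rewrite -(pair_bigA _ (fun s' a' => trans M s a s' * pi s' a' * f s' a')) /=.
apply: eq_bigr => s' _; rewrite mulr_sumr; apply: eq_bigr => a' _.
by rewrite mulrA.
Qed.

Lemma expect_path_prefix T (F : {ffun 'I_T.+2 -> S * A} -> R)
    (G : {ffun 'I_T.+1 -> S * A} -> R) (f : S -> A -> R) :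
  (forall tau x, F (ext_path (tau, x)) = G tau + f x.1 x.2) ->
  expect_path M rho pi F = expect_path M rho pi G +
    \sum_s chain_law P rho T.+1 s * \sum_a pi s a * f s a.
Proof.
move=> FG; rewrite -expect_path_last !expect_path_succ /expect_path -big_split /=.
apply: eq_bigr => tau _; rewrite -mulrDr; congr (_ * _).
under eq_bigr do rewrite FG mulrDr.
rewrite big_split /=; congr (_ + _); last first.
  by apply: eq_bigr => x _; rewrite ext_path_last.
rewrite -mulr_suml -[RHS]mul1r; congr (_ * _).
rewrite -(pair_bigA _ (fun s' a' => trans M _ _ s' * pi s' a')) /=.
rewrite -[RHS](proj2 (trans_dist M (tau ord_max).1 (tau ord_max).2)).
apply: eq_bigr => s' _; rewrite -mulr_sumr.
by rewrite (proj2 (pi_pol s')) mulr1.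
Qed.

Lemma expect_path_return T (f : S -> A -> R) :
  expect_path M rho pi (T := T) (fun tau =>
    \sum_(t < T.+1) gamma M ^+ t * f (tau t).1 (tau t).2) =
  \sum_(t < T.+1) gamma M ^+ t *
     \sum_s chain_law P rho t s * \sum_a pi s a * f s a.
Proof.
elim: T => [|T IH].
  rewrite big_ord_recr big_ord0 /= add0r expr0 mul1r -(@expect_path_last 0).
  apply: eq_bigr => tau _; congr (_ * _).
  rewrite big_ord_recr big_ord0 /= add0r expr0 mul1r.
  by congr (f (tau _).1 (tau _).2); exact: val_inj.
rewrite big_ord_recr /= -IH.
rewrite (@expect_path_prefix _ _ (fun tau => \sum_(t < T.+1) gamma M ^+ t *
   f (tau t).1 (tau t).2) (fun s a => gamma M ^+ T.+1 * f s a)); last first.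
  move=> tau x; rewrite big_ord_recr /= ext_path_last; congr (_ + _).
  by apply: eq_bigr => t _; rewrite ext_path_widen.
congr (_ + _); rewrite mulr_sumr; apply: eq_bigr => s _.
rewrite mulrCA; congr (_ * _); rewrite mulr_sumr.
by apply: eq_bigr => a _; rewrite mulrCA.
Qed.

Lemma state_prob_law t s : state_prob M rho pi t s = chain_law P rho t s.
Proof.
rewrite /state_prob (@expect_path_last t (fun s' a => (s' == s)%:R)).
rewrite (bigD1 s)//= [X in _ + X]big1 ?addr0.
  by rewrite -mulr_suml (proj2 (pi_pol s)) eqxx !mulr1.
by move=> s' /negPf ->; rewrite big1 ?mulr0// => a _; rewrite mulr0.
Qed.

Lemma occupancyE s : occupancy M rho pi s = chain_occ P (gamma M) rho s.
Proof.
rewrite /occupancy /chain_occ; congr (_ * _).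
congr (lim (_ @ \oo)); apply/funext => T.
by apply: eq_bigr => t _; rewrite state_prob_law.
Qed.

End Paths.

Section PolicyValue.
Variables (R : realType) (S A : finType) (M : mdp R S A).
Variables (lam : R) (piref : S -> A -> R).
Implicit Types (rho x : S -> R) (pi : S -> A -> R).

(** Expected one-step regularized reward. *)
Definition step_reward pi s : R :=
  \sum_a pi s a * (reward M s a - lam * rkl piref pi s).

(** [x] solves the linear policy-evaluation equation of [pi]. *)
Definition bellman_solution pi x : Prop := forall s,
  x s = step_reward pi s + gamma M * \sum_s' policy_kernel M pi s s' * x s'.

(** The value, defined as a limit of truncated returns, is the average of any
    solution of the policy-evaluation equation. *)
Lemma value_bellman rho pi x : is_dist rho -> is_policy pi ->
  bellman_solution pi x -> value M lam piref rho pi = \sum_s rho s * x s.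
Proof.
move=> Hr Hp Hx; rewrite /value.
under eq_fun => T do rewrite (@expect_path_return _ _ _ M rho pi Hp T
  (fun s a => reward M s a - lam * rkl piref pi s)).
apply/cvg_lim => //.
have := discounted_sum_cvg (policy_kernel_dist M Hp) (gamma_bound M) Hr Hx.
by rewrite -cvg_shiftS.
Qed.

Lemma sum_dirac (I : finType) (i : I) (f : I -> R) :
  \sum_j (j == i)%:R * f j = f i.
Proof.
rewrite (bigD1 i)//= eqxx mul1r big1 ?addr0// => j /negPf ->.
by rewrite mul0r.
Qed.

Lemma dirac_dist_dist s : is_dist (dirac_dist R s : S -> R).
Proof.
split=> [s'|]; first by rewrite /dirac_dist ler0n.
rewrite -[RHS](sum_dirac s (fun=> 1)); apply: eq_bigr => s' _.
by rewrite mulr1.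
Qed.

Lemma state_value_bellman pi : is_policy pi ->
  bellman_solution pi (state_value M lam piref pi).
Proof.
move=> Hp.
have [x Hx] := resolvent_exists (policy_kernel_dist M Hp) (gamma_bound M)
  (step_reward pi).
have -> : state_value M lam piref pi = x; last exact: Hx.
apply/funext => s; rewrite /state_value.
by rewrite (value_bellman (dirac_dist_dist s) Hp Hx) sum_dirac.
Qed.

Lemma valueE rho pi : is_dist rho -> is_policy pi ->
  value M lam piref rho pi = \sum_s rho s * state_value M lam piref pi s.
Proof.
by move=> Hr Hp; apply: value_bellman => //; exact: state_value_bellman.
Qed.

Lemma occupancy_resolvent rho pi x : is_dist rho -> is_policy pi ->
  \sum_s occupancy M rho pi s *
     (x s - gamma M * \sum_s' policy_kernel M pi s s' * x s') =
  (1 - gamma M) * \sum_s rho s * x s.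
Proof.
move=> Hr Hp; under eq_bigr do rewrite occupancyE//.
exact (chain_occ_resolvent (policy_kernel_dist M Hp) (gamma_bound M) x Hr).
Qed.

Lemma occupancy_dist rho pi : is_dist rho -> is_policy pi ->
  is_dist (occupancy M rho pi).
Proof.
move=> Hr Hp; have -> : occupancy M rho pi =
    chain_occ (policy_kernel M pi) (gamma M) rho.
  by apply/funext => s; rewrite occupancyE.
exact (chain_occ_dist (policy_kernel_dist M Hp) (gamma_bound M) Hr).
Qed.

Lemma occupancy_ge rho pi s : is_dist rho -> is_policy pi ->
  (1 - gamma M) * rho s <= occupancy M rho pi s.
Proof.
move=> Hr Hp; rewrite occupancyE//.
exact (chain_occ_ge (policy_kernel_dist M Hp) (gamma_bound M) s Hr).
Qed.

(** Regularized performance difference lemma, against an arbitrary function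
    [x] in place of the value of a second policy. *)
Lemma performance_difference rho pi x : is_dist rho -> is_policy pi ->
  (1 - gamma M) * (value M lam piref rho pi - \sum_s rho s * x s) =
  \sum_s occupancy M rho pi s * (step_reward pi s +
     gamma M * (\sum_s' policy_kernel M pi s s' * x s') - x s).
Proof.
move=> Hr Hp; rewrite valueE// -sumrB.
under [X in _ * X]eq_bigr do rewrite -mulrBr.
rewrite -(occupancy_resolvent
  (fun s => state_value M lam piref pi s - x s) Hr Hp).
apply: eq_bigr => s _; congr (_ * _).
under eq_bigr do rewrite mulrBr; rewrite sumrB.
by rewrite {1}(state_value_bellman Hp s); ring.
Qed.

End PolicyValue.

(** * The optimal regularized policy *)

(** Kullback-Leibler divergence of [p] from [q]; the vanishing
    entries of [p] contribute nothing. *)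
Definition kl (R : realType) (A : finType) (p q : A -> R) : R :=
  \sum_a p a * ln (p a / q a).

Section KL.
Variables (R : realType) (A : finType).
Implicit Types p q : A -> R.

Lemma kl_ge_sqdist p q : is_dist p -> is_dist q -> (forall a, 0 < q a) ->
  (\sum_a (p a - q a) ^+ 2) / 2 <= kl p q.
Proof.
move=> Hp Hq q0; rewrite mulr_suml.
have -> : kl p q = \sum_a (p a * ln (p a / q a) - p a + q a).
  by rewrite big_split sumrB /= (proj2 Hp) (proj2 Hq) subrK.
apply: ler_sum => a _; apply: kl_term_ge.
  by rewrite (proj1 Hp) dist_le1.
by rewrite q0 dist_le1.
Qed.

Lemma kl_ge0 p q : is_dist p -> is_dist q -> (forall a, 0 < q a) -> 0 <= kl p q.
Proof.
move=> Hp Hq q0; apply: le_trans (kl_ge_sqdist Hp Hq q0).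
by rewrite divr_ge0// sumr_ge0// => a _; exact: sqr_ge0.
Qed.

Lemma kl_self p : (forall a, 0 < p a) -> kl p p = 0.
Proof.
by move=> p0; apply: big1 => a _; rewrite divff ?gt_eqF// ln1 mulr0.
Qed.

End KL.

Section SoftOptimal.
Variables (R : realType) (S A : finType) (M : mdp R S A).
Variables (lam : R) (piref : S -> A -> R).
Hypotheses (lam_gt0 : 0 < lam) (piref_policy : is_policy piref).
Hypothesis piref_gt0 : forall s a, 0 < piref s a.
Implicit Types (rho x W : S -> R) (pi : S -> A -> R).

(** Unregularized one-step lookahead with continuation value [W]. *)
Definition backup W s a : R :=
  reward M s a + gamma M * \sum_s' trans M s a s' * W s'.

Lemma step_backup pi x s : is_policy pi ->
  step_reward M lam piref pi s + gamma M * (\sum_s' policy_kernel M pi s s' * x s') =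
  \sum_a pi s a * backup x s a - lam * rkl piref pi s.
Proof.
move=> Hp; rewrite /step_reward.
under eq_bigr do rewrite mulrBr; rewrite sumrB -mulr_suml (proj2 (Hp s)) mul1r.
rewrite addrAC; congr (_ - _).
under [RHS]eq_bigr do rewrite mulrDr; rewrite big_split /=; congr (_ + _).
under eq_bigr do rewrite mulr_suml; rewrite exchange_big mulr_sumr /=.
apply: eq_bigr => a _; rewrite !mulr_sumr; apply: eq_bigr => s' _.
by ring.
Qed.

(** Soft Bellman operator: the closed form of the maximum, over action
    distributions [p], of the mean of the backup under [p] minus
    [lam * kl p (piref s)]. *)
Definition soft_bellman W s : R :=
  lam * ln (\sum_a piref s a * expR (backup W s a / lam)).

Let part_gt0 W s : 0 < \sum_a piref s a * expR (backup W s a / lam).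
Proof.
have [a _] := dist_inhabited (piref_policy s).
rewrite (bigD1 a)//= ltr_pwDl ?mulr_gt0 ?expR_gt0//.
by apply: sumr_ge0 => b _; rewrite mulr_ge0 ?expR_ge0 ?ltW.
Qed.

Let backup_close W W' c s a : (forall s', `|W s' - W' s'| <= c) ->
  `|backup W s a - backup W' s a| <= gamma M * c.
Proof.
move=> h; case/andP: (gamma_bound M) => g0 _.
rewrite /backup opprD addrACA subrr add0r -mulrBr -sumrB.
rewrite normrM ger0_norm// ler_wpM2l//.
under eq_bigr do rewrite -mulrBr.
exact: (dist_mean_bound (trans_dist M s a)).
Qed.

Let soft_bellman_le W W' c s : (forall a, backup W s a <= backup W' s a + c) ->
  soft_bellman W s <= soft_bellman W' s + c.
Proof.
move=> h; rewrite /soft_bellman.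
have -> : c = lam * (c / lam) by rewrite mulrC divfK ?gt_eqF.
rewrite -mulrDr ler_pM2l// -[c / lam]expRK -lnM ?posrE ?expR_gt0//.
rewrite ler_ln ?posrE ?mulr_gt0 ?expR_gt0//.
rewrite mulr_suml; apply: ler_sum => a _.
by rewrite -mulrA -expRD ler_pM2l// ler_expR -mulrDl ler_pM2r// invr_gt0.
Qed.

Let soft_bellman_contract W W' c : (forall s', `|W s' - W' s'| <= c) ->
  forall s, `|soft_bellman W s - soft_bellman W' s| <= gamma M * c.
Proof.
move=> h s; rewrite ler_distl; apply/andP; split.
  rewrite lerBlDr; apply: soft_bellman_le => a.
  have := backup_close s a h; rewrite ler_distl => /andP[h1 _].
  by rewrite -lerBlDr.
apply: soft_bellman_le => a.
by have := backup_close s a h; rewrite ler_distl => /andP[].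
Qed.

(** The soft-optimal policy [pistar], and the identity that drives the analysis:
    the suboptimality of any policy is the occupancy-weighted divergence to
    [pistar]. *)
Lemma soft_optimal_exists : exists pistar,
  [/\ is_policy pistar, forall s a, 0 < pistar s a &
   forall rho pi, is_dist rho -> is_policy pi ->
    (1 - gamma M) * (value M lam piref rho pistar - value M lam piref rho pi) =
    lam * \sum_s occupancy M rho pi s * kl (pi s) (pistar s)].
Proof.
have [|W HW] := @sup_contraction_fixpoint R S (gamma M) soft_bellman (gamma_bound M).
  by move=> x y c; exact: soft_bellman_contract.
pose pistar s a := piref s a * expR ((backup W s a - W s) / lam).
have pistar_gt0 s a : 0 < pistar s a by rewrite mulr_gt0 ?expR_gt0.
have pistar_pol : is_policy pistar.
  move=> s; split=> [a|]; first exact: ltW.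
  rewrite /pistar; under eq_bigr do rewrite mulrBl expRB mulrA.
  rewrite -mulr_suml -[in X in _ / X]HW /soft_bellman.
  by rewrite [lam * _]mulrC mulfK ?gt_eqF// lnK ?posrE// divff ?gt_eqF.
(* Because [pistar] is the Gibbs tilt of [piref] by [backup W], the Bellman residual
   of [W] under any policy is exactly a divergence. *)
have one_step pi s : is_policy pi -> step_reward M lam piref pi s +
     gamma M * (\sum_s' policy_kernel M pi s s' * W s') - W s =
     - (lam * kl (pi s) (pistar s)).
  move=> Hp; rewrite step_backup// /kl /rkl.
  rewrite -[W s]mul1r -(proj2 (Hp s)) mulr_suml !mulr_sumr -!sumrB -sumrN.
  apply: eq_bigr => a _; have [p0 _] := Hp s.
  have [->|pn0] := eqVneq (pi s a) 0; first by rewrite !mul0r !mulr0 subrr subr0 oppr0.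
  have pa : 0 < pi s a by rewrite lt_neqAle eq_sym pn0 p0.
  rewrite !ln_div ?posrE// /pistar lnM ?posrE ?expR_gt0// expRK.
  by field; rewrite gt_eqF.
have subopt rho pi : is_dist rho -> is_policy pi ->
    (1 - gamma M) * (\sum_s rho s * W s - value M lam piref rho pi) =
    lam * \sum_s occupancy M rho pi s * kl (pi s) (pistar s).
  move=> Hr Hp; rewrite -[X in _ * X]opprB mulrN performance_difference// -sumrN mulr_sumr.
  by apply: eq_bigr => s _; rewrite one_step// mulrN opprK mulrCA.
exists pistar; split=> // rho pi Hr Hp.
rewrite -(subopt _ _ Hr Hp); congr (_ * (_ - _)).
apply: (value_bellman Hr pistar_pol) => s; apply/eqP.
by rewrite eq_sym -subr_eq0 one_step// kl_self// mulr0 oppr0.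
Qed.

End SoftOptimal.

(** * Regularized softmax ascent at a single state *)

(** Softmax of one row of logits. *)
Definition smx (R : realType) (A : finType) (th : A -> R) (a : A) : R :=
  expR (th a) / \sum_b expR (th b).

(** Centered regularized advantage of the action [a] at the distribution [p],
    with reference distribution [q]. *)
Definition reg_adv (R : realType) (A : finType) (lam : R) (q adv p : A -> R)
    (a : A) : R :=
  adv a - \sum_b p b * adv b - lam * (ln (p a / q a) - kl p q).

(** Gradient, with respect to the logits of [p], of the regularized linear
    objective [sum_a p a * adv a - lam * kl p q]. *)
Definition logit_grad (R : realType) (A : finType) (lam : R) (q adv p : A -> R)
    (a : A) : R := p a * reg_adv lam q adv p a.

Section Softmax.
Variables (R : realType) (A : finType).
Implicit Types (th v : A -> R).

Lemma sum_expR_gt0 th (a : A) : 0 < \sum_b expR (th b).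
Proof.
rewrite (bigD1 a)//= ltr_pwDl ?expR_gt0//.
by apply: sumr_ge0 => b _; exact: expR_ge0.
Qed.

Lemma smx_gt0 th a : 0 < smx th a.
Proof. by rewrite divr_gt0 ?expR_gt0// sum_expR_gt0. Qed.

Lemma smx_dist th (a0 : A) : is_dist (smx th).
Proof.
split=> [a|]; first exact/ltW/smx_gt0.
by rewrite -mulr_suml divff// gt_eqF// sum_expR_gt0.
Qed.

(** Moving the logits by at most [e] multiplies each probability by a factor in
    [exp (-2 e), exp (2 e)], whatever the size of that probability. *)
Lemma smx_tilt th th' (a0 : A) e : (forall a, `|th' a - th a| <= e) ->
  exists c, `|c| <= e /\
    forall a, smx th' a = smx th a * expR (th' a - th a - c).
Proof.
move=> he; have Z0 := sum_expR_gt0 th a0; have Z0' := sum_expR_gt0 th' a0.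
set Z := \sum_b expR (th b) in Z0 *; set Z' := \sum_b expR (th' b) in Z0' *.
exists (ln (Z' / Z)); split.
  have hb b : th b - e <= th' b <= th b + e by rewrite -ler_distl; exact: he.
  have ZZ : 0 < Z' / Z by rewrite divr_gt0.
  rewrite ler_norml; apply/andP; split.
    rewrite -[leLHS]expRK ler_ln ?posrE ?expR_gt0// ler_pdivlMr// mulr_sumr.
    apply: ler_sum => b _; rewrite -expRD ler_expR addrC.
    by case/andP: (hb b).
  rewrite -[leRHS]expRK ler_ln ?posrE ?expR_gt0// ler_pdivrMr// mulr_sumr.
  apply: ler_sum => b _; rewrite -expRD ler_expR addrC.
  by case/andP: (hb b).
move=> a; rewrite /smx -/Z -/Z' expRB expRB lnK ?posrE ?divr_gt0//.
have hE := expR_gt0 (th a).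
by field; rewrite !gt_eqF.
Qed.

End Softmax.

Section Bandit.
Variables (R : realType) (A : finType) (lam : R) (q : A -> R) (L Am : R).
Hypotheses (lam_gt0 : 0 < lam) (q_dist : is_dist q) (q_gt0 : forall a, 0 < q a).
Hypothesis q_ln : forall a, `|ln (q a)| <= L.
Implicit Types (adv p th : A -> R).

Let N : R := #|A|%:R.

(** Bound on the entries of the logit gradient. Like the next two constants, it
    does not depend on how close [p] is to the boundary of the simplex. *)
Definition grad_bound : R := 2 * Am + lam * (expR (-1) + 2 * L).
(** Lipschitz constant of the logit gradient, for the maximum norm of the logits. *)
Definition grad_lip : R :=
  4 * grad_bound + 4 * Am + lam * (4 + 4 * N * (expR (-1) + L)).
(** Constant of the second-order error of the regularized objective. *)
Definition grad_curv : R := 8 * N * grad_bound + 8 * lam.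

Lemma sum_const_le (f : A -> R) c : (forall a, f a <= c) -> \sum_a f a <= N * c.
Proof.
move=> fc; apply: le_trans (ler_sum _ (fun a _ => fc a)) _.
by rewrite sumr_const -mulr_natl.
Qed.

Lemma ln_ratio_bound p a : is_dist p -> (forall b, 0 < p b) ->
  `|p a * ln (p a / q a)| <= expR (-1) + L.
Proof.
move=> Hp p0; rewrite ln_div ?posrE// mulrBr (le_trans (ler_normB _ _))//.
apply: lerD; first by apply: entropy_term_bound; rewrite p0 dist_le1.
rewrite normrM gtr0_norm// (le_trans _ (q_ln a))// ler_piMl//.
by rewrite dist_le1.
Qed.

Lemma kl_ref_bound p : is_dist p -> 0 <= kl p q <= L.
Proof.
move=> Hp; rewrite kl_ge0//=.
rewrite -[leRHS]mul1r -(proj2 Hp) mulr_suml; apply: ler_sum => a _.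
have [->|pn0] := eqVneq (p a) 0; first by rewrite !mul0r.
have pa : 0 < p a by rewrite lt_neqAle eq_sym pn0 (proj1 Hp).
rewrite ler_pM2l// ln_div ?posrE//.
have := ln_le0 (dist_le1 a Hp).
by have := q_ln a; rewrite ler_norml => /andP[h1 h2] h3; lra.
Qed.

Lemma reg_adv_mean0 adv p : is_dist p -> \sum_a p a * reg_adv lam q adv p a = 0.
Proof.
move=> Hp; rewrite /reg_adv; set X := \sum_b p b * adv b.
transitivity (\sum_a (p a * adv a - p a * X +
    ((- lam) * (p a * ln (p a / q a)) + p a * (lam * kl p q)))).
  by apply: eq_bigr => a _; ring.
rewrite big_split sumrB big_split /= -!mulr_suml -mulr_sumr (proj2 Hp).
by rewrite -/(kl p q) -/X; ring.
Qed.

Lemma logit_grad_sum0 adv p : is_dist p -> \sum_a logit_grad lam q adv p a = 0.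
Proof. exact: reg_adv_mean0. Qed.

Lemma logit_grad_bound adv p a : is_dist p -> (forall b, 0 < p b) ->
  (forall b, `|adv b| <= Am) -> `|logit_grad lam q adv p a| <= grad_bound.
Proof.
move=> Hp p0 hA; have := dist_mean_bound Hp hA; have := ln_ratio_bound a Hp p0.
have /andP[k0 kL] := kl_ref_bound Hp; have p1 := dist_le1 a Hp; have hAa := hA a.
have pa := p0 a.
rewrite /logit_grad /reg_adv.
set X := \sum_b p b * adv b; set E := expR (-1); set l := ln _; set k := kl p q.
rewrite -/k in k0 kL.
move=> hl hX.
have -> : p a * (adv a - X - lam * (l - k)) =
   p a * (adv a - X) + (- lam) * (p a * l - p a * k) by ring.
rewrite (le_trans (ler_normD _ _))// /grad_bound; apply: lerD.
  rewrite normrM gtr0_norm// (le_trans (ler_wpM2l (ltW pa) (ler_normB _ _)))//.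
  have := normr_ge0 (adv a); have := normr_ge0 X => h1 h2.
  by nra.
rewrite normrM normrN (gtr0_norm lam_gt0) ler_pM2l// (le_trans (ler_normB _ _))//.
have -> : `|p a * k| = p a * k by rewrite ger0_norm// mulr_ge0// ltW.
by rewrite -/E in hl *; nra.
Qed.

(** Rare actions have a nonnegative gradient. *)
Lemma logit_grad_ge0 adv p a : is_dist p -> (forall b, 0 < p b) ->
  (forall b, `|adv b| <= Am) -> p a <= q a * expR (- (2 * Am / lam)) ->
  0 <= logit_grad lam q adv p a.
Proof.
move=> Hp p0 hA ha; rewrite mulr_ge0 ?(ltW (p0 _))// /reg_adv.
have := dist_mean_bound Hp hA; have /andP[k0 _] := kl_ref_bound Hp.
have := hA a; rewrite !ler_norml => /andP[h1 h2] /andP[h3 h4].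
have hl : ln (p a / q a) <= - (2 * Am / lam).
  rewrite -[leRHS]expRK ler_ln ?posrE ?expR_gt0 ?divr_gt0//.
  by rewrite ler_pdivrMr// mulrC.
have : lam * (ln (p a / q a) - kl p q) <= lam * (- (2 * Am / lam)).
  by rewrite ler_pM2l//; lra.
have hd : lam * (2 * Am / lam) = 2 * Am by rewrite mulrC divfK ?gt_eqF.
rewrite mulrN hd => h5; lra.
Qed.

Section Perturbation.
Variables (adv th th' : A -> R) (a0 : A) (e : R).
Hypotheses (adv_bound : forall a, `|adv a| <= Am).
Hypotheses (th_close : forall a, `|th' a - th a| <= e) (e_small : e <= 1 / 4).

Let p := smx th.
Let p' := smx th'.
Let p_gt0 a : 0 < p a. Proof. exact: smx_gt0. Qed.
Let p'_gt0 a : 0 < p' a. Proof. exact: smx_gt0. Qed.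
Let p_dist : is_dist p. Proof. exact: smx_dist. Qed.
Let p'_dist : is_dist p'. Proof. exact: smx_dist. Qed.
Let d a := ln (p' a / p a).

Let tilt : exists c, forall a, d a = th' a - th a - c /\ `|d a| <= 2 * e.
Proof.
have [c [hc h]] := smx_tilt a0 th_close; exists c => a.
have -> : d a = th' a - th a - c.
  by rewrite /d /p' h mulrAC divff ?mul1r ?expRK// gt_eqF// p_gt0.
split=> //; rewrite (le_trans (ler_normB _ _))//.
by have := th_close a => h'; lra.
Qed.

Let d_bound a : `|d a| <= 2 * e.
Proof. by case: tilt => c /(_ a)[]. Qed.

Let p'E a : p' a = p a * expR (d a).
Proof.
rewrite /d lnK ?posrE; first by rewrite mulrC divfK// gt_eqF.
by rewrite divr_gt0.
Qed.

Let d_half a : `|d a| <= 1 / 2.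
Proof. by have h1 := d_bound a; have h2 := e_small; lra. Qed.

Lemma smx_close a : `|smx th' a - smx th a| <= 4 * e * smx th a.
Proof.
rewrite -/(p a) -/(p' a) p'E -[X in _ - X]mulr1 -mulrBr normrM gtr0_norm//.
rewrite mulrC ler_pM2r// (le_trans (expR_sub1_bound (d_half a)))//.
by have := d_bound a => h; lra.
Qed.

Lemma smx_ratio_close a : `|smx th' a / smx th a - 1| <= 4 * e.
Proof.
have p0 := p_gt0 a; rewrite -[X in _ - X](@divff _ (p a)) ?gt_eqF// -mulrBl normrM.
rewrite normfV (gtr0_norm p0) ler_pdivrMr//.
exact: smx_close.
Qed.

Let diff_sum_bound (f : A -> R) c : (forall a, p a * `|f a| <= c) ->
  `|\sum_a (p' a - p a) * f a| <= 4 * e * (N * c).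
Proof.
move=> hf; rewrite (le_trans (ler_norm_sum _ _ _))//.
have e0 : 0 <= e by exact: le_trans (normr_ge0 _) (th_close a0).
apply: le_trans (_ : \sum_a 4 * e * (p a * `|f a|) <= _).
  apply: ler_sum => a _; rewrite normrM mulrA ler_wpM2r//.
  exact: smx_close.
rewrite -mulr_sumr ler_wpM2l ?mulr_ge0//.
exact: sum_const_le.
Qed.

Let diff_adv_bound : `|\sum_a (p' a - p a) * adv a| <= 4 * e * Am.
Proof.
rewrite (le_trans (ler_norm_sum _ _ _))//.
have -> : 4 * e * Am = \sum_a p a * (4 * e * Am).
  by rewrite -mulr_suml (proj2 p_dist) mul1r.
apply: ler_sum => a _; rewrite normrM.
apply: le_trans (ler_pM (normr_ge0 _) (normr_ge0 _) (smx_close a) (adv_bound a)) _.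
by rewrite -/(p a) le_eqVlt; apply/orP; left; apply/eqP; ring.
Qed.

Let kl_diff_bound : `|kl p' q - kl p q| <= 4 * e * (N * (expR (-1) + L)) + 2 * e.
Proof.
have -> : kl p' q - kl p q =
    \sum_a (p' a - p a) * ln (p a / q a) + \sum_a p' a * d a.
  rewrite -sumrB -big_split /=; apply: eq_bigr => a _.
  rewrite /d (ln_ratio (p'_gt0 a) (p_gt0 a)) (ln_ratio (p_gt0 a) (q_gt0 a)).
  by rewrite (ln_ratio (p'_gt0 a) (q_gt0 a)); ring.
rewrite (le_trans (ler_normD _ _))// lerD//.
  apply: diff_sum_bound => a.
  rewrite -{1}(gtr0_norm (p_gt0 a)) -normrM.
  exact: ln_ratio_bound.
exact: dist_mean_bound p'_dist d_bound.
Qed.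

(** The logit gradient is Lipschitz in the logits, uniformly: the unbounded
    logarithms enter only multiplied by a probability, or through the difference of
    two of them, which the logit displacement controls. *)
Lemma logit_grad_lip a :
  `|logit_grad lam q adv p' a - logit_grad lam q adv p a| <= grad_lip * e.
Proof.
have e0 : 0 <= e by exact: le_trans (normr_ge0 _) (th_close a0).
have hb : `|p a * reg_adv lam q adv p a| <= grad_bound.
  exact: logit_grad_bound.
rewrite /logit_grad.
have -> : p' a * reg_adv lam q adv p' a - p a * reg_adv lam q adv p a =
  (p' a - p a) * reg_adv lam q adv p a +
  p' a * (- (\sum_b (p' b - p b) * adv b) - lam * d a + lam * (kl p' q - kl p q)).
  have -> : \sum_b (p' b - p b) * adv b =
      \sum_b p' b * adv b - \sum_b p b * adv b.
    by rewrite -sumrB; apply: eq_bigr => b _; rewrite mulrBl.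
  rewrite /reg_adv /d (ln_ratio (p'_gt0 a) (p_gt0 a)).
  rewrite (ln_ratio (p_gt0 a) (q_gt0 a)) (ln_ratio (p'_gt0 a) (q_gt0 a)).
  by ring.
rewrite (le_trans (ler_normD _ _))//.
have h1 : `|(p' a - p a) * reg_adv lam q adv p a| <= 4 * e * grad_bound.
  rewrite normrM; apply: le_trans (ler_wpM2r (normr_ge0 _) (smx_close a)) _.
  rewrite -(mulrA (4 * e)) ler_wpM2l ?mulr_ge0//.
  by rewrite -/(p a) -{1}(gtr0_norm (p_gt0 a)) -normrM.
have h2 : `|p' a * (- (\sum_b (p' b - p b) * adv b) - lam * d a +
     lam * (kl p' q - kl p q))| <=
  4 * e * Am + lam * (2 * e) + lam * (4 * e * (N * (expR (-1) + L)) + 2 * e).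
  rewrite normrM gtr0_norm//.
  apply: le_trans (ler_piMl (normr_ge0 _) (dist_le1 a p'_dist)) _.
  rewrite (le_trans (ler_normD _ _))//; apply: lerD.
    rewrite (le_trans (ler_normB _ _))// normrN; apply: lerD => //.
    by rewrite normrM gtr0_norm// ler_pM2l.
  by rewrite normrM gtr0_norm// ler_pM2l.
apply: le_trans (lerD h1 h2) _; rewrite /grad_lip le_eqVlt; apply/orP; left.
by apply/eqP; ring.
Qed.

End Perturbation.

(** Exact increment of the regularized objective: the first-order term minus the
    divergence from the starting point. *)
Lemma reg_gain_expand adv p p' : is_dist p -> (forall a, 0 < p a) ->
  is_dist p' -> \sum_a p a * adv a = 0 ->
  \sum_a p' a * adv a - lam * kl p' q + lam * kl p q =
  \sum_a (p' a - p a) * reg_adv lam q adv p a - lam * kl p' p.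
Proof.
move=> Hp p0 Hp' adv0.
under [in RHS]eq_bigr do rewrite mulrBl.
rewrite sumrB reg_adv_mean0// subr0 /reg_adv adv0.
rewrite -[in LHS](mul1r (lam * kl p q)) -(proj2 Hp').
move: (kl p q) => k; rewrite mulr_suml [kl p' q]/kl [kl p' p]/kl.
rewrite !mulr_sumr -sumrB -big_split -sumrB /=.
apply: eq_bigr => a _.
have [->|pn0] := eqVneq (p' a) 0; first by rewrite !mul0r !mulr0 subrr !addr0.
have pa : 0 < p' a by rewrite lt_neqAle eq_sym pn0 (proj1 Hp').
by rewrite !ln_div ?posrE//; ring.
Qed.

(** Gradient domination: the best regularized gain is controlled by the squared
    regularized advantage. *)
Lemma reg_gain_le adv p p' : is_dist p -> (forall a, 0 < p a) ->
  is_dist p' -> \sum_a p a * adv a = 0 ->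
  \sum_a p' a * adv a - lam * kl p' q + lam * kl p q <=
  (\sum_a reg_adv lam q adv p a ^+ 2) / (2 * lam).
Proof.
move=> Hp p0 Hp' adv0; rewrite reg_gain_expand//.
have := kl_ge_sqdist Hp' Hp p0; rewrite -(ler_pM2l lam_gt0) => h.
apply: le_trans (lerB (lexx _) h) _.
rewrite !mulr_suml mulr_sumr -sumrB; apply: ler_sum => a _.
rewrite ler_pdivlMr ?mulr_gt0//.
have h' := sqr_ge0 (reg_adv lam q adv p a - lam * (p' a - p a)).
by move: h'; rewrite -subr_ge0 => h'; nra.
Qed.

(** Ascent: second-order lower bound on the gain of a small logit step. *)
Lemma reg_gain_ge adv th th' (a0 : A) e : (forall a, `|adv a| <= Am) ->
  \sum_a smx th a * adv a = 0 ->
  (forall a, `|th' a - th a| <= e) -> e <= 1 / 4 ->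
  \sum_a logit_grad lam q adv (smx th) a * (th' a - th a) - grad_curv * e ^+ 2 <=
  \sum_a smx th' a * adv a - lam * kl (smx th') q + lam * kl (smx th) q.
Proof.
move=> hA adv0 he e4.
have e0 : 0 <= e by exact: le_trans (normr_ge0 _) (he a0).
have p0 a : 0 < smx th a by exact: smx_gt0.
have p0' a : 0 < smx th' a by exact: smx_gt0.
have Hp := smx_dist th a0; have Hp' := smx_dist th' a0.
rewrite reg_gain_expand//.
have [c [hc ht]] := smx_tilt a0 he.
set p := smx th in p0 Hp adv0 ht *; set p' := smx th' in p0' Hp' ht *.
pose d a := th' a - th a - c.
have dE a : ln (p' a / p a) = d a.
  by rewrite ht mulrAC divff ?mul1r ?expRK// gt_eqF.
have d2 a : `|d a| <= 2 * e.
  by rewrite (le_trans (ler_normB _ _))//; have := he a => h; lra.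
have d12 a : `|d a| <= 1 / 2 by rewrite (le_trans (d2 a))//; lra.
have dsq a : d a ^+ 2 <= 4 * e ^+ 2.
  have -> : d a ^+ 2 = `|d a| ^+ 2 by rewrite real_normK// num_real.
  have h1 := d2 a; have h2 := normr_ge0 (d a); nra.
have hkl : kl p' p <= 8 * e ^+ 2.
  have h : 0 <= kl p p' by apply: kl_ge0.
  have klN : kl p p' = - \sum_a p a * d a.
    rewrite -sumrN; apply: eq_bigr => a _; rewrite -mulrN -dE.
    by rewrite (ln_ratio (p0 a) (p0' a)) (ln_ratio (p0' a) (p0 a)) opprB.
  apply: le_trans (_ : kl p' p + kl p p' <= _); first by rewrite lerDl.
  have -> : 8 * e ^+ 2 = \sum_a p a * (8 * e ^+ 2).
    by rewrite -mulr_suml (proj2 Hp) mul1r.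
  rewrite klN -sumrB.
  apply: ler_sum => a _; rewrite dE -mulrBl.
  apply: le_trans (ler_norm _) _; rewrite normrM.
  apply: le_trans (ler_pM (normr_ge0 _) (normr_ge0 _)
    (smx_close a0 he e4 a) (d2 a)) _.
  by rewrite -/p le_eqVlt; apply/orP; left; apply/eqP; ring.
have h1 : \sum_a logit_grad lam q adv p a * (th' a - th a) =
    \sum_a p a * d a * reg_adv lam q adv p a.
  transitivity (\sum_a (logit_grad lam q adv p a * d a +
      c * logit_grad lam q adv p a)).
    by apply: eq_bigr => a _; rewrite /d; ring.
  rewrite big_split /= -mulr_sumr logit_grad_sum0// mulr0 addr0.
  by apply: eq_bigr => a _; rewrite mulrAC.
have h2 : \sum_a p a * d a * reg_adv lam q adv p a -
     \sum_a (p' a - p a) * reg_adv lam q adv p a <= N * (8 * e ^+ 2 * grad_bound).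
  rewrite -sumrB; apply: sum_const_le => a; rewrite -mulrBl ht -/(d a).
  have -> : (p a * d a - (p a * expR (d a) - p a)) * reg_adv lam q adv p a =
    - ((expR (d a) - 1 - d a) * logit_grad lam q adv p a).
    by rewrite /logit_grad; ring.
  apply: le_trans (ler_norm _) _; rewrite normrN normrM.
  have /andP[x0 x1] := expR_quad (d12 a).
  apply: ler_pM => //; last exact: logit_grad_bound.
  by rewrite ger0_norm// (le_trans x1)//; have := dsq a => h; lra.
rewrite h1 /grad_curv.
have h3 : lam * kl p' p <= lam * (8 * e ^+ 2) by rewrite ler_pM2l.
by lra.
Qed.

End Bandit.

(** * One outer iteration at a single state *)

(** Smallness of the effective total stepsize [y] of an inner loop. The first
    condition keeps the gradient entries along the loop below twice the largest
    initial one, the next three keep the logit displacement below [1 / 4] and the ratios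
    inside the clipping range, and the last one makes the error terms at most half
    of the first-order gain. *)
Definition small_step (R : realType) (A : finType) (lam L Am el eh y : R) : Prop :=
  [/\ y * (2 * grad_lip A lam L Am) <= 1,
      [/\ y * (8 * grad_bound lam L Am) <= 1, y * (8 * grad_bound lam L Am) <= el
      & y * (8 * grad_bound lam L Am) <= eh]
    & y * (4 * #|A|%:R * grad_lip A lam L Am + 8 * grad_curv A lam L Am) <= 1].

(** Inside the clipping range the convention at the kinks plays no role. *)
Lemma clip_deriv_id (R : realType) (el eh adv v : R) : 1 - el <= v <= 1 + eh ->
  clip_deriv el eh adv v = adv.
Proof.
move=> /andP[h1 h2]; rewrite /clip_deriv h1 h2 !andbT.
by have [//|//] := leP 0 adv.
Qed.

Lemma clip_deriv_bound (R : realType) (el eh adv v : R) :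
  `|clip_deriv el eh adv v| <= `|adv|.
Proof. by rewrite /clip_deriv; case: ifP => _ //; rewrite normr0. Qed.

Section InnerLoop.
Variables (R : realType) (A : finType) (lam : R) (q : A -> R) (L Am el eh : R).
Hypotheses (lam_gt0 : 0 < lam) (q_dist : is_dist q) (q_gt0 : forall a, 0 < q a).
Hypothesis q_ln : forall a, `|ln (q a)| <= L.

Lemma exists_max_norm (h : A -> R) (a0 : A) :
  exists m : R, [/\ 0 <= m, forall a, `|h a| <= m, m ^+ 2 <= \sum_a h a ^+ 2 &
    exists a, m = `|h a|].
Proof.
case: (@Order.TotalTheory.arg_maxP _ _ _ a0 predT (fun a => `|h a|) isT) => am _ hm.
exists `|h am|; split=> //; first by move=> a; exact: hm.
  rewrite real_normK ?num_real// (bigD1 am)//= lerDl.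
  by apply: sumr_ge0 => a _; exact: sqr_ge0.
by exists am.
Qed.

(** While the logits stay close to their initial value, no ratio is clipped, so the
    inner loop is gradient ascent on one and the same objective; its gain is at
    least half of the total stepsize times the squared initial gradient. *)
Lemma inner_loop_gain (adv : A -> R) (x : nat -> A -> R) (eta : nat -> R)
    (w : R) (K : nat) (a0 : A) :
  (forall a, `|adv a| <= Am) -> \sum_a smx (x 1%N) a * adv a = 0 -> 0 <= w ->
  (forall k, (1 <= k <= K)%N -> 0 <= eta k) ->
  (forall k, (1 <= k <= K)%N -> forall a, x k.+1 a = x k a + eta k * (w *
     logit_grad lam q (fun b =>
        clip_deriv el eh (adv b) (smx (x k) b / smx (x 1%N) b)) (smx (x k)) a)) ->
  let y := w * \sum_(1 <= k < K.+1) eta k in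
  small_step A lam L Am el eh y ->
  y / 2 * \sum_a logit_grad lam q adv (smx (x 1%N)) a ^+ 2 <=
  \sum_a smx (x K.+1) a * adv a - lam * kl (smx (x K.+1)) q
    + lam * kl (smx (x 1%N)) q.
Proof.
move=> hA adv0 w0 eta0 hx y [c1 [c2 c3 c4] c5].
set p := smx (x 1%N).
pose h a := logit_grad lam q adv p a.
have p0 a : 0 < p a by exact: smx_gt0.
have Hp : is_dist p := smx_dist _ a0.
have [m [m0 hm m2 [am mE]]] := exists_max_norm h a0.
have mH : m <= grad_bound lam L Am 
    by rewrite mE; exact: (logit_grad_bound lam_gt0 q_dist q_gt0 q_ln am Hp p0 hA).
pose Sk k := \sum_(1 <= j < k.+1) eta j.
have Sk0 k : (k <= K)%N -> 0 <= Sk k.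
  move=> kK; rewrite /Sk big_nat; apply: sumr_ge0 => j /andP[j1 jk].
  by apply: eta0; rewrite j1 (leq_trans _ kK).
have SkS k : (k <= K)%N -> Sk k <= Sk K.
  move=> kK; rewrite /Sk (@big_cat_nat _ _ _ k.+1 1 K.+1)//= lerDl big_nat.
  apply: sumr_ge0 => j /andP[j1 jk]; apply: eta0.
  by rewrite (leq_trans _ j1).
have y0 : 0 <= y by rewrite mulr_ge0//; exact: Sk0.
have hL0 : 0 <= grad_lip A lam L Am.
  have h1 (a : A) : `|(0 : R) - 0| <= 1 / 4 by rewrite subrr normr0; lra.
  have h2 := @logit_grad_lip R A lam q L Am lam_gt0 q_dist q_gt0 q_ln adv
    (fun=> 0) (fun=> 0) a0 (1 / 4) hA h1 (lexx _) a0.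
  by move: h2; rewrite subrr normr0 pmulr_lge0// divr_gt0.
set C1 := grad_lip A lam L Am in c1 c5 hL0.
set C2 := grad_curv A lam L Am in c5.
set H := grad_bound lam L Am in c2 c3 c4 mH.
(* [e] bounds the total displacement of the logits during the inner loop. *)
pose e := 2 * y * m.
have e0 : 0 <= e by rewrite /e mulr_ge0// mulr_ge0.
have eH : 4 * e <= y * (8 * H).
  have hh : y * m <= y * H by rewrite ler_wpM2l.
  by rewrite /e; lra.
have e4 : e <= 1 / 4 by lra.
(* The displacement after [k] steps is the one that the initial gradient [h] alone
   would produce, up to an error of [C1 * e] per unit of effective stepsize. *)
have key k : (k <= K)%N -> forall a,
    `|x k.+1 a - x 1%N a - w * Sk k * h a| <= w * Sk k * (C1 * e).
  have disp j : (j <= K)%N ->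
      (forall a, `|x j.+1 a - x 1%N a - w * Sk j * h a| <= w * Sk j * (C1 * e)) ->
      forall a, `|x j.+1 a - x 1%N a| <= e.
    move=> jK hj a; have := hj a.
    have u1 : w * Sk j <= y by rewrite ler_wpM2l//; exact: SkS.
    have u0 : 0 <= w * Sk j by rewrite mulr_ge0//; exact: Sk0.
    have hma := hm a.
    have ha : `|w * Sk j * h a| <= y * m.
      by rewrite normrM ger0_norm// ler_pM.
    have C1e : C1 * e <= m.
      have -> : C1 * e = y * (2 * C1) * m by rewrite /e; ring.
      by rewrite ler_piMl.
    have hb : w * Sk j * (C1 * e) <= y * m.
      by rewrite ler_pM// mulr_ge0.
    move=> hj'.
    have -> : x j.+1 a - x 1%N a =
      (x j.+1 a - x 1%N a - w * Sk j * h a) + w * Sk j * h a by rewrite subrK.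
    by rewrite (le_trans (ler_normD _ _))// /e; lra.
  elim: k => [|k IH] kK a.
    by rewrite /Sk big_geq// mulr0 !mul0r subr0 subrr normr0.
  have kK' : (k <= K)%N := ltnW kK.
  have hk := disp k kK' (IH kK').
  have SkE : Sk k.+1 = Sk k + eta k.+1 by rewrite /Sk big_nat_recr.
  have ek : 0 <= eta k.+1 by apply: eta0.
  rewrite hx//.
  rewrite (_ : (fun b => _) = adv); last first.
    apply/funext => b; apply: clip_deriv_id.
    have := smx_ratio_close a0 hk e4 b; rewrite ler_norml => /andP[r1 r2].
    by apply/andP; split; lra.
  have lip := logit_grad_lip lam_gt0 q_dist q_gt0 q_ln a0 hA hk e4 a.
  have -> : x k.+1 a + eta k.+1 * (w * logit_grad lam q adv (smx (x k.+1)) a)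
      - x 1%N a - w * Sk k.+1 * h a =
    (x k.+1 a - x 1%N a - w * Sk k * h a) +
    w * eta k.+1 * (logit_grad lam q adv (smx (x k.+1)) a - h a).
    by rewrite SkE; ring.
  rewrite (le_trans (ler_normD _ _))// SkE [in leRHS]mulrDr [in leRHS]mulrDl; apply: lerD.
    exact: IH.
  by rewrite normrM ger0_norm ?mulr_ge0// ler_wpM2l// mulr_ge0.
have disp a : `|x K.+1 a - x 1%N a| <= e.
  have := key K (leqnn K) a; rewrite -/y => hk.
  have ha : `|y * h a| <= y * m by rewrite normrM ger0_norm// ler_wpM2l.
  have C1e : C1 * e <= m.
    have -> : C1 * e = y * (2 * C1) * m by rewrite /e; ring.
    by rewrite ler_piMl.
  have hb : y * (C1 * e) <= y * m by rewrite ler_wpM2l.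
  have -> : x K.+1 a - x 1%N a =
    (x K.+1 a - x 1%N a - y * h a) + y * h a by rewrite subrK.
  by rewrite (le_trans (ler_normD _ _))// /e; lra.
apply: le_trans (reg_gain_ge lam_gt0 q_dist q_gt0 q_ln a0 hA adv0 disp e4).
rewrite -/C2 -/p.
set Q := \sum_a h a ^+ 2 in m2 *.
have first_order : y * Q - #|A|%:R * (m * (y * (C1 * e))) <=
    \sum_a h a * (x K.+1 a - x 1%N a).
  rewrite lerBlDr -lerBlDl mulr_sumr -sumrB.
  apply: sum_const_le => a.
  have -> : y * h a ^+ 2 - h a * (x K.+1 a - x 1%N a) =
    - (h a * (x K.+1 a - x 1%N a - y * h a)) by ring.
  apply: le_trans (ler_norm _) _; rewrite normrN normrM ler_pM//.
  exact: key.
have last : #|A|%:R * (m * (y * (C1 * e))) + C2 * e ^+ 2 =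
    y / 2 * (y * (4 * #|A|%:R * C1 + 8 * C2)) * m ^+ 2.
  by rewrite /e; field.
have : y / 2 * (y * (4 * #|A|%:R * C1 + 8 * C2)) * m ^+ 2 <= y / 2 * Q.
  have y2 : 0 <= y / 2 by rewrite divr_ge0.
  rewrite -mulrA ler_wpM2l//.
  apply: le_trans m2; apply: ler_piMl => //; exact: sqr_ge0.
rewrite -last => hl.
have -> : \sum_a logit_grad lam q adv p a * (x K.+1 a - x 1%N a) =
  \sum_a h a * (x K.+1 a - x 1%N a) by [].
by lra.
Qed.

End InnerLoop.

(** * The gradient of the surrogate *)

Section Gradient.
Variables (R : realType) (S A : finType).
Implicit Types (theta : S -> A -> R).

Lemma is_derive_fin_sum (I : finType) (h : I -> R -> R) (dh : I -> R) (x : R) :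
  (forall i, is_derive x 1 (h i) (dh i)) ->
  is_derive x 1 (fun t => \sum_i h i t) (\sum_i dh i).
Proof.
move=> H; rewrite -fct_sumE; elim/big_ind2 : _ => //.
  exact: is_derive_cst.
by move=> f df g dg Hf Hg; exact: is_deriveD.
Qed.

Lemma shift_coord0 theta s a : shift_coord theta s a 0 = theta.
Proof.
by apply/funext => x; apply/funext => y; rewrite /shift_coord mul0r addr0.
Qed.

Lemma softmax_smx theta s : softmax theta s = smx (theta s).
Proof. by []. Qed.

(** Partial derivative, along the logit of [(s, a)], of the softmax probability of
    [a'] at [s']. *)
Definition softmax_partial theta s a s' a' : R :=
  (s' == s)%:R * (softmax theta s' a' * ((a' == a)%:R - softmax theta s' a)).

Lemma is_derive_softmax theta s a s' a' :
  is_derive (0 : R) 1 (fun t : R => softmax (shift_coord theta s a t) s' a')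
    (softmax_partial theta s a s' a').
Proof.
pose dl b : R := ((s' == s) && (b == a))%:R.
have He b : is_derive (0 : R) 1
    (fun t : R => expR (shift_coord theta s a t s' b)) (expR (theta s' b) * dl b).
  have hlin : is_derive (0 : R) 1 (fun t : R => theta s' b + t * dl b) (dl b).
    by apply: is_derive_eq; rewrite /GRing.scale /=; ring.
  have h := @is_derive1_comp R expR (fun t : R => theta s' b + t * dl b) 0 _ _
    (is_derive_expR _) hlin.
  by move: h; congr is_derive; rewrite mul0r addr0.
have Hsum := is_derive_fin_sum He.
set Zf := (fun t : R => \sum_i _) in Hsum.
have Z0E : Zf 0 = \sum_b expR (theta s' b).
  by apply: eq_bigr => b _; rewrite shift_coord0.
have Zgt0 : 0 < \sum_b expR (theta s' b) by exact: sum_expR_gt0.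
have Zn0 : Zf 0 != 0 by rewrite Z0E gt_eqF.
have HM := is_deriveM (He a') (is_deriveV Zn0 Hsum).
move: HM; congr is_derive; rewrite /softmax_partial Z0E !shift_coord0.
rewrite /softmax /GRing.scale /=.
have dsum : \sum_i expR (theta s' i) * dl i = (s' == s)%:R * expR (theta s' a).
  rewrite (bigD1 a)//= /dl eqxx andbT big1 ?addr0 1?mulrC// => b /negPf ->.
  by rewrite andbF mulr0.
have dlE : dl a' = (s' == s)%:R * (a' == a)%:R by rewrite /dl -mulnb natrM.
rewrite dsum dlE; move: Zgt0 => {dsum dlE Zn0 Z0E Hsum He dl Zf}.
set Z := \sum_b _ => Zgt0.
move: (_ s' s : bool)%:R => x1; move: (_ a' a : bool)%:R => x2.
move: (expR (theta s' a')) (expR (theta s' a)) => e1 e2.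
by field; rewrite gt_eqF.
Qed.

Variables (M : mdp R S A) (lam : R) (piref : S -> A -> R) (u : S -> R).
Variables (el eh : R) (pi0 : S -> A -> R).
Hypothesis piref_gt0 : forall s a, 0 < piref s a.
Hypothesis pi0_gt0 : forall s a, 0 < pi0 s a.

Let is_derive_scaled theta s a s' a' (c : R) :
  is_derive (0 : R) 1 (fun t : R => softmax (shift_coord theta s a t) s' a' / c)
    (softmax_partial theta s a s' a' / c).
Proof.
have := is_deriveM (is_derive_softmax theta s a s' a') (is_derive_cst c^-1 (0 : R) 1).
by congr is_derive; rewrite /GRing.scale /= mulr0 add0r mulrC.
Qed.

Lemma partial_prob_ratio theta s a s' a' :
  partial (fun th => prob_ratio pi0 th s' a') theta s a =
  softmax_partial theta s a s' a' / pi0 s' a'.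
Proof.
rewrite /partial derive1E.
exact: (@derive_val _ _ _ _ _ _ _ (is_derive_scaled theta s a s' a' (pi0 s' a'))).
Qed.

Lemma partial_reg_term theta s a s' a' :
  partial (fun th => reg_term piref pi0 th s' a') theta s a =
  softmax_partial theta s a s' a' / pi0 s' a' * (ln (softmax theta s' a' / piref s' a') + 1).
Proof.
rewrite /partial derive1E.
have sg : 0 < softmax theta s' a' by exact: smx_gt0.
have hq := is_derive_scaled theta s a s' a' (piref s' a').
have hln : is_derive (softmax (shift_coord theta s a 0) s' a' / piref s' a') 1
    (@ln R) (softmax (shift_coord theta s a 0) s' a' / piref s' a')^-1.
  by apply: is_derive1_ln; rewrite shift_coord0 divr_gt0.
have hc := @is_derive1_comp R (@ln R)
  (fun t : R => softmax (shift_coord theta s a t) s' a' / piref s' a') 0 _ _ hln hq.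
have HM := is_deriveM (is_derive_scaled theta s a s' a' (pi0 s' a')) hc.
have -> : softmax_partial theta s a s' a' / pi0 s' a' * (ln (softmax theta s' a' / piref s' a') + 1)
  = (softmax (shift_coord theta s a 0) s' a' / pi0 s' a') *:
      ((softmax (shift_coord theta s a 0) s' a' / piref s' a')^-1 *
       (softmax_partial theta s a s' a' / piref s' a')) +
    ln (softmax (shift_coord theta s a 0) s' a' / piref s' a') *:
      (softmax_partial theta s a s' a' / pi0 s' a').
  rewrite !shift_coord0 /GRing.scale /=.
  by field; rewrite !gt_eqF.
exact: (@derive_val _ _ _ _ _ _ _ HM).
Qed.

(** The surrogate gradient decouples over the states: at [s] it is the logit
    gradient for the clipped advantages, scaled by the occupancy. *)
Lemma surrogate_gradE theta s a :
  surrogate_grad M lam piref u el eh pi0 theta s a =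
  occupancy M u pi0 s / (1 - gamma M) *
  logit_grad lam (piref s) (fun b => clip_deriv el eh
     (advantage M lam piref pi0 s b) (prob_ratio pi0 theta s b)) (smx (theta s)) a.
Proof.
rewrite /surrogate_grad /expect_occ [occupancy _ _ _ _ / _]mulrC -mulrA.
congr (_ * _).
set adv := fun s' b => clip_deriv el eh (advantage M lam piref pi0 s' b)
   (prob_ratio pi0 theta s' b).
rewrite (bigD1 s)//= [X in _ + X]big1 ?addr0; last first.
  move=> s' /negPf ss'; rewrite big1 ?mulr0// => a' _.
  rewrite partial_prob_ratio partial_reg_term /softmax_partial ss'.
  by rewrite !mul0r mulr0 mulr0 subr0 mulr0.
congr (_ * _).
have Hp : is_dist (smx (theta s)) by exact: smx_dist.
pose p := smx (theta s); pose l b := ln (p b / piref s b).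
pose c b := adv s b - lam * (l b + 1).
transitivity (\sum_b ((b == a)%:R * (p b * c b) - p a * (p b * c b))).
  apply: eq_bigr => b _; rewrite partial_prob_ratio partial_reg_term /softmax_partial eqxx.
  rewrite /= -/(adv s b) softmax_smx -/p -/(l b) /c.
  by field; rewrite gt_eqF.
rewrite sumrB -mulr_sumr sum_dirac -/p /logit_grad /reg_adv -/(l a).
have -> : \sum_b p b * c b = \sum_b p b * adv s b - lam * kl p (piref s) - lam.
  transitivity (\sum_b (p b * adv s b - lam * (p b * l b) - p b * lam)).
    by apply: eq_bigr => b _; rewrite /c; ring.
  by rewrite !sumrB -mulr_sumr -mulr_suml (proj2 Hp) mul1r.
by rewrite /c -/(adv s _) -/p; ring.
Qed.

End Gradient.

(** * Bounds on values, advantages and gradients *)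

Section Bounds.
Variables (R : realType) (S A : finType) (M : mdp R S A).
Variables (lam : R) (piref : S -> A -> R).
Hypotheses (lam_gt0 : 0 < lam) (piref_policy : is_policy piref).
Hypothesis piref_gt0 : forall s a, 0 < piref s a.
Implicit Types (pi : S -> A -> R).

Let g_lt1 : 0 < 1 - gamma M.
Proof. by case/andP: (gamma_bound M) => _; rewrite subr_gt0. Qed.

Lemma L_ref_bound s a : `|ln (piref s a)| <= L_ref piref.
Proof.
exact: (le_bigmax _ (fun sa : S * A => `|ln (piref sa.1 sa.2)|) (s, a)).
Qed.

Lemma c_ref_le s a : c_ref piref <= piref s a.
Proof. exact: (bigmin_le _ (s, a) (fun sa : S * A => piref sa.1 sa.2)). Qed.

Lemma L_ref_ge0 : 0 <= L_ref piref.
Proof. exact: bigmax_ge_id. Qed.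

Lemma rkl_bound pi s : is_policy pi -> 0 <= rkl piref pi s <= L_ref piref.
Proof.
move=> Hp; exact: (kl_ref_bound (piref_policy s) (piref_gt0 s) (L_ref_bound s) (Hp s)).
Qed.

Lemma step_reward_bound pi s : is_policy pi ->
  - (lam * L_ref piref) <= step_reward M lam piref pi s <= rmax M.
Proof.
move=> Hp; have /andP[k0 kL] := rkl_bound s Hp.
have h a : - (lam * L_ref piref) <= reward M s a - lam * rkl piref pi s <= rmax M.
  have /andP[r0 r1] := reward_bound M s a.
  have h1 : lam * rkl piref pi s <= lam * L_ref piref by rewrite ler_pM2l.
  have h2 : 0 <= lam * rkl piref pi s by rewrite mulr_ge0// ltW.
  by apply/andP; split; lra.
have [p0 p1] := Hp s.
have mean c : \sum_a pi s a * c = c by rewrite -mulr_suml p1 mul1r.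
apply/andP; split.
  by rewrite -[leLHS]mean; apply: ler_sum => a _; rewrite ler_wpM2l//; case/andP: (h a).
by rewrite -[leRHS]mean; apply: ler_sum => a _; rewrite ler_wpM2l//; case/andP: (h a).
Qed.

Lemma state_value_bound pi s : is_policy pi ->
  - (lam * L_ref piref) <= (1 - gamma M) * state_value M lam piref pi s <= rmax M.
Proof.
move=> Hp; have Hd := dirac_dist_dist R s.
have [ o0 o1] := occupancy_dist M Hd Hp.
have mean c : \sum_s' occupancy M (dirac_dist R s) pi s' * c = c.
  by rewrite -mulr_suml o1 mul1r.
have := performance_difference M lam piref (fun=> 0) Hd Hp.
rewrite big1 => [|s' _]; last by rewrite mulr0.
rewrite subr0 -/(state_value M lam piref pi s) => ->.
have stepE s' : step_reward M lam piref pi s' + gamma M *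
   (\sum_s'0 policy_kernel M pi s' s'0 * 0) - 0 = step_reward M lam piref pi s'.
  by rewrite big1 ?mulr0 ?addr0 ?subr0// => s'' _; rewrite mulr0.
apply/andP; split.
  rewrite -[leLHS]mean; apply: ler_sum => s' _; rewrite ler_wpM2l// stepE.
  by case/andP: (step_reward_bound s' Hp).
rewrite -[leRHS]mean; apply: ler_sum => s' _; rewrite ler_wpM2l// stepE.
by case/andP: (step_reward_bound s' Hp).
Qed.

Lemma state_value_backup pi s : is_policy pi ->
  state_value M lam piref pi s =
  \sum_a pi s a * backup M (state_value M lam piref pi) s a - lam * rkl piref pi s.
Proof.
by move=> Hp; rewrite -step_backup//; exact: state_value_bellman.
Qed.

(** The regularization of the current step cancels in the advantage. *)
Lemma advantageE pi s a : is_policy pi ->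
  advantage M lam piref pi s a =
  backup M (state_value M lam piref pi) s a -
  \sum_b pi s b * backup M (state_value M lam piref pi) s b.
Proof.
move=> Hp; rewrite /advantage [in X in _ - X]state_value_backup// /q_value /backup.
by ring.
Qed.

Lemma advantage_mean0 pi s : is_policy pi ->
  \sum_a pi s a * advantage M lam piref pi s a = 0.
Proof.
move=> Hp; under eq_bigr do rewrite advantageE// mulrBr.
by rewrite sumrB -mulr_suml (proj2 (Hp s)) mul1r subrr.
Qed.

Lemma advantage_bound pi s a : is_policy pi ->
  `|advantage M lam piref pi s a| <= A_max M lam piref.
Proof.
move=> Hp; rewrite advantageE//.
case/andP: (gamma_bound M) => g0 g1.
set V := state_value M lam piref pi.
have hb b : - (lam * L_ref piref) <= (1 - gamma M) * backup M V s b <= rmax M.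
  have [t0 t1] := trans_dist M s b; have /andP[r0 r1] := reward_bound M s b.
  have mean c : \sum_s' trans M s b s' * c = c by rewrite -mulr_suml t1 mul1r.
  have : - (lam * L_ref piref) <= (1 - gamma M) * (\sum_s' trans M s b s' * V s') <= rmax M.
    rewrite mulr_sumr; apply/andP; split.
      rewrite -[leLHS]mean; apply: ler_sum => s' _; rewrite mulrCA ler_wpM2l//.
      by case/andP: (state_value_bound s' Hp).
    rewrite -[leRHS]mean; apply: ler_sum => s' _; rewrite mulrCA ler_wpM2l//.
    by case/andP: (state_value_bound s' Hp).
  rewrite /backup; set W := \sum_s' _ => /andP[w0 w1].
  have l0 : 0 <= lam * L_ref piref by rewrite mulr_ge0 ?L_ref_ge0// ltW.
  have g0' : 0 <= 1 - gamma M by rewrite ltW.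
  have e1 : 0 <= (1 - gamma M) * reward M s b by rewrite mulr_ge0.
  have e2 : (1 - gamma M) * reward M s b <= (1 - gamma M) * rmax M by rewrite ler_wpM2l.
  have e3 : gamma M * ((1 - gamma M) * W) <= gamma M * rmax M by rewrite ler_wpM2l.
  have e4 : gamma M * (- (lam * L_ref piref)) <= gamma M * ((1 - gamma M) * W).
    by rewrite ler_wpM2l.
  have e5 : 0 <= (1 - gamma M) * (lam * L_ref piref) by rewrite mulr_ge0.
  by apply/andP; split; lra.
have [p0 p1] := Hp s.
have mean c : \sum_b pi s b * c = c by rewrite -mulr_suml p1 mul1r.
have : - (lam * L_ref piref) <= (1 - gamma M) * (\sum_b pi s b * backup M V s b) <= rmax M.
  rewrite mulr_sumr; apply/andP; split.
    rewrite -[leLHS]mean; apply: ler_sum => b _; rewrite mulrCA ler_wpM2l//.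
    by case/andP: (hb b).
  rewrite -[leRHS]mean; apply: ler_sum => b _; rewrite mulrCA ler_wpM2l//.
  by case/andP: (hb b).
case/andP: (hb a); move: (backup M V s a) (\sum_b _) => x y h1 h2 /andP[h3 h4].
rewrite /A_max ler_pdivlMr// -(gtr0_norm g_lt1) -normrM ler_norml.
by apply/andP; split; lra.
Qed.

Lemma A_max_ge0 (s : S) (a : A) : 0 <= A_max M lam piref.
Proof.
exact: le_trans (normr_ge0 _) (advantage_bound s a piref_policy).
Qed.

(** One-step form of the performance difference, expressed with the advantage. *)
Lemma one_step_gain pi pi' s : is_policy pi -> is_policy pi' ->
  step_reward M lam piref pi' s + gamma M *
    (\sum_s' policy_kernel M pi' s s' * state_value M lam piref pi s')
    - state_value M lam piref pi s =
  \sum_a pi' s a * advantage M lam piref pi s a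
    - lam * kl (pi' s) (piref s) + lam * kl (pi s) (piref s).
Proof.
move=> Hp Hp'; rewrite step_backup// [X in _ - X]state_value_backup//.
under [in RHS]eq_bigr do rewrite advantageE// mulrBr.
rewrite sumrB -mulr_suml (proj2 (Hp' s)) mul1r /rkl -!/(kl _ _).
by ring.
Qed.

Lemma value_difference rho pi pi' : is_dist rho -> is_policy pi -> is_policy pi' ->
  (1 - gamma M) * (value M lam piref rho pi' - value M lam piref rho pi) =
  \sum_s occupancy M rho pi' s *
    (\sum_a pi' s a * advantage M lam piref pi s a
       - lam * kl (pi' s) (piref s) + lam * kl (pi s) (piref s)).
Proof.
move=> Hr Hp Hp'; rewrite (valueE M lam piref Hr Hp) performance_difference//.
by apply: eq_bigr => s _; rewrite one_step_gain.
Qed.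

Lemma softmax_policy (th : S -> A -> R) : is_policy (softmax th).
Proof.
move=> s; rewrite softmax_smx.
by have [a0 _] := dist_inhabited (piref_policy s); exact: smx_dist.
Qed.

Variables (u : S -> R) (el eh : R).
Hypothesis u_dist : is_dist u.
Variable th0 : S -> A -> R.

Let grad := surrogate_grad M lam piref u el eh (softmax th0).

Let gradE th s a : grad th s a =
  occupancy M u (softmax th0) s / (1 - gamma M) *
  logit_grad lam (piref s) (fun b => clip_deriv el eh
     (advantage M lam piref (softmax th0) s b) (prob_ratio (softmax th0) th s b))
   (smx (th s)) a.
Proof. by apply: surrogate_gradE => // s' a'; exact: smx_gt0. Qed.

Let clip_bound th s b : `|clip_deriv el eh
   (advantage M lam piref (softmax th0) s b) (prob_ratio (softmax th0) th s b)|
  <= A_max M lam piref.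
Proof.
apply: le_trans (clip_deriv_bound _ _ _ _) _.
exact/advantage_bound/softmax_policy.
Qed.

Let occ_ge0 s : 0 <= occupancy M u (softmax th0) s / (1 - gamma M).
Proof.
apply: divr_ge0; last exact: ltW.
by have [ o0 _] := occupancy_dist M u_dist (softmax_policy th0).
Qed.

Lemma surrogate_grad_sum0 th s :
  \sum_a surrogate_grad M lam piref u el eh (softmax th0) th s a = 0.
Proof.
under eq_bigr do rewrite -/(grad _ _ _) gradE; rewrite -mulr_sumr.
by rewrite logit_grad_sum0 ?mulr0//; exact: (softmax_policy th s).
Qed.

Lemma surrogate_grad_bound th s a :
  `|surrogate_grad M lam piref u el eh (softmax th0) th s a| <= G_inf M lam piref.
Proof.
rewrite -/(grad _ _ _) gradE normrM ger0_norm// /G_inf mulrAC mulrC.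
have [ o0 o1] := occupancy_dist M u_dist (softmax_policy th0).
rewrite [leRHS]mulrC ler_pM2l ?invr_gt0// -[leRHS]mul1r.
rewrite ler_pM//; first exact: (dist_le1 _ (conj o0 o1)).
apply: (logit_grad_bound lam_gt0 (piref_policy s) (piref_gt0 s) (L_ref_bound s)).
- exact: (softmax_policy th s).
- by move=> b; exact: smx_gt0.
- exact: clip_bound.
Qed.

Lemma surrogate_grad_ge0 th s a : softmax th s a <= tau_R M lam piref ->
  0 <= surrogate_grad M lam piref u el eh (softmax th0) th s a.
Proof.
move=> ha; rewrite -/(grad _ _ _) gradE; apply: mulr_ge0 => //.
apply: (logit_grad_ge0 lam_gt0 (piref_policy s) (piref_gt0 s) (L_ref_bound s)
  (Am := A_max M lam piref)).
- exact: (softmax_policy th s).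
- by move=> b; exact: smx_gt0.
- exact: clip_bound.
- apply: le_trans ha _; rewrite /tau_R ler_wpM2r ?expR_ge0//.
  exact: c_ref_le.
Qed.

End Bounds.

(** * Uniform lower bound on the iterates *)

Section Centered.
Variables (R : realType) (S A : finType).
Implicit Types th : S -> A -> R.

Let N_gt0 (a0 : A) : 0 < #|A|%:R :> R.
Proof. by rewrite ltr0n; apply/card_gt0P; exists a0. Qed.

Lemma centered_sum0 th s (a0 : A) : \sum_b centered th s b = 0.
Proof.
rewrite /centered sumrB sumr_const -[X in _ - X]mulr_natl mulrA divff ?mul1r ?subrr//.
by rewrite gt_eqF// N_gt0.
Qed.

Lemma centered_diff th s a b : centered th s b - centered th s a = th s b - th s a.
Proof. by rewrite /centered; ring. Qed.

(** By convexity the exponentials of the centered logits sum to at least [#|A|]. *)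
Lemma softmax_le_centered th s a :
  softmax th s a <= expR (centered th s a) / #|A|%:R.
Proof.
have N0 := N_gt0 a.
have Z0 : 0 < \sum_b expR (th s b) by exact: sum_expR_gt0.
rewrite /softmax ler_pdivrMr// mulrAC ler_pdivlMr//.
set m := #|A|%:R^-1 * \sum_b th s b.
have -> : centered th s a = th s a - m by [].
rewrite expRB -mulrA ler_pM2l ?expR_gt0// mulrC ler_pdivlMr ?expR_gt0//.
have -> : #|A|%:R = \sum_b (1 + centered th s b) :> R.
  by rewrite big_split /= (centered_sum0 _ _ a) addr0 sumr_const.
rewrite mulr_suml; apply: ler_sum => b _.
have -> : expR (th s b) = expR (centered th s b) * expR m.
  by rewrite -expRD; congr expR; rewrite /centered -/m subrK.
by rewrite ler_pM2r ?expR_gt0// expR_ge1Dx.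
Qed.

(** A lower bound on the centered logits also bounds their differences, because
    they sum to zero. *)
Lemma softmax_ge_of_centered th s a l : (forall b, l <= centered th s b) ->
  (1 + (#|A|%:R - 1) * expR (- (#|A|%:R * l)))^-1 <= softmax th s a.
Proof.
move=> hl; have N0 := N_gt0 a.
have N1 : 1 <= #|A|%:R :> R by rewrite ler1n; apply/card_gt0P; exists a.
have Z0 : 0 < \sum_b expR (th s b) by exact: sum_expR_gt0.
have D0 : 0 < 1 + (#|A|%:R - 1) * expR (- (#|A|%:R * l)).
  by rewrite ltr_pwDl// mulr_ge0 ?expR_ge0// subr_ge0.
set E := expR (- (#|A|%:R * l)).
have hb b : expR (th s b) <= expR (th s a) * E.
  rewrite -expRD ler_expR -lerBlDl -centered_diff.
  have : \sum_c (centered th s c - l) = - (#|A|%:R * l).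
    by rewrite sumrB (centered_sum0 _ _ a) sumr_const sub0r mulr_natl.
  rewrite (bigD1 b)//= => <-.
  have := hl a; have : 0 <= \sum_(i | i != b) (centered th s i - l).
    by apply: sumr_ge0 => c _; rewrite subr_ge0.
  by move=> h1 h2; lra.
have hsum : \sum_b expR (th s b) <= expR (th s a) * (1 + (#|A|%:R - 1) * E).
  have -> : expR (th s a) * (1 + (#|A|%:R - 1) * E) =
     expR (th s a) + \sum_(b | b != a) expR (th s a) * E.
    have : \sum_(b : A) expR (th s a) * E = #|A|%:R * (expR (th s a) * E).
      by rewrite sumr_const mulr_natl.
    rewrite (bigD1 a)//= => h.
    have -> : \sum_(i | i != a) expR (th s a) * E =
      #|A|%:R * (expR (th s a) * E) - expR (th s a) * E by rewrite -h addrAC subrr add0r.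
    by ring.
  by rewrite (bigD1 a)//= lerD2l; apply: ler_sum => b _; exact: hb.
by rewrite /softmax ler_pdivlMr// ler_pdivrMl// mulrC.
Qed.

End Centered.

Section Run.
Variables (R : realType) (S A : finType) (M : mdp R S A).
Variables (lam : R) (piref : S -> A -> R) (u : S -> R) (el eh : R) (K : nat).
Hypotheses (lam_gt0 : 0 < lam) (piref_policy : is_policy piref).
Hypothesis c_ref_gt0 : 0 < c_ref piref.
Hypothesis u_dist : is_dist u.

Lemma piref_gt0 s a : 0 < piref s a.
Proof. exact: lt_le_trans c_ref_gt0 (c_ref_le _ _ _). Qed.

Variables (theta11 : S -> A -> R) (eta : nat -> nat -> R).
Variables (theta : nat -> nat -> S -> A -> R) (Ssum : R).
Hypothesis eta_ge0 : forall n k, (1 <= n)%N -> (1 <= k <= K)%N -> 0 <= eta n k.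
Hypothesis eta_sum : forall n, (1 <= n)%N -> \sum_(1 <= k < K.+1) eta n k = Ssum.
Hypothesis run : ppo_run M lam piref u el eh K theta11 eta theta.

Let low := theta_low M lam piref theta11 Ssum.

Lemma eta_le_sum n k : (1 <= n)%N -> (1 <= k <= K)%N -> eta n k <= Ssum.
Proof.
move=> n1 /andP[k1 kK]; rewrite -(eta_sum n1).
rewrite (@big_cat_nat _ _ _ k 1 K.+1)//=; last exact: leqW.
rewrite [X in _ + X]big_ltn//.
have h1 : 0 <= \sum_(1 <= i < k) eta n i.
  rewrite big_nat; apply: sumr_ge0 => i /andP[i1 ik]; apply: eta_ge0 => //.
  by rewrite i1 (leq_trans (ltnW ik)).
have h2 : 0 <= \sum_(k.+1 <= i < K.+1) eta n i.
  rewrite big_nat; apply: sumr_ge0 => i /andP[i1 ik]; apply: eta_ge0 => //.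
  by rewrite (leq_trans _ i1).
by lra.
Qed.

(** The centered logits never fall below [theta_low]: a rare action has a
    nonnegative gradient, and a non-rare one moves by at most [Ssum * G_inf] in a
    single step. *)
Lemma centered_ge_low n k : (1 <= n)%N -> (1 <= k <= K.+1)%N ->
  forall s a, low <= centered (theta n k) s a.
Proof.
have [h1 hstep hnext] := run.
have N0 (a : A) : 0 < #|A|%:R :> R by rewrite ltr0n; apply/card_gt0P; exists a.
have tau0 : 0 < tau_R M lam piref by rewrite mulr_gt0 ?expR_gt0.
have inner m : (1 <= m)%N -> (forall s a, low <= centered (theta m 1%N) s a) ->
    forall j, (1 <= j <= K.+1)%N -> forall s a, low <= centered (theta m j) s a.
  move=> m1 h0; elim=> [//|j IH] /andP[_ jK] s a.
  have [->|j0] := eqVneq j 0%N; first exact: h0.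
  have jr : (1 <= j <= K)%N by rewrite lt0n j0.
  have {}IH := IH (introT andP (conj (proj1 (andP jr)) (leqW (proj2 (andP jr))))) s.
  set g := surrogate_grad M lam piref u el eh (softmax (theta m 1%N)) (theta m j).
  have cE : centered (theta m j.+1) s a = centered (theta m j) s a + eta m j * g s a.
    rewrite /centered hstep// -/g.
    under [X in _ - _ * X]eq_bigr do rewrite hstep// -/(g _ _).
    rewrite big_split /= -mulr_sumr (surrogate_grad_sum0 _ _ piref_policy)//.
      by rewrite mulr0 addr0 addrAC.
    exact: piref_gt0.
  rewrite cE.
  have e0 := eta_ge0 m1 jr.
  have [small|large] := leP (centered (theta m j) s a) (ln (#|A|%:R * tau_R M lam piref)).
    have g0 : 0 <= g s a.
      apply: surrogate_grad_ge0 => //; first exact: piref_gt0.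
      apply: le_trans (softmax_le_centered _ _ _) _.
      rewrite (ler_pdivrMr _ _ (N0 a)) mulrC -[leRHS]lnK ?ler_expR//.
      by rewrite posrE mulr_gt0// N0.
    by rewrite (le_trans (IH a))// lerDl mulr_ge0.
  have gb : `|g s a| <= G_inf M lam piref.
    by apply: surrogate_grad_bound => //; exact: piref_gt0.
  have h2 : eta m j * `|g s a| <= Ssum * G_inf M lam piref.
    by rewrite ler_pM//; exact: eta_le_sum.
  have h3 : - (eta m j * `|g s a|) <= eta m j * g s a.
    by rewrite -mulrN ler_wpM2l// lerNl -normrN ler_norm.
  have h4 : low <= ln (#|A|%:R * tau_R M lam piref) - Ssum * G_inf M lam piref.
    by rewrite /low /theta_low ge_min lexx orbT.
  by clear N0; lra.
have start m : (1 <= m)%N -> forall s a, low <= centered (theta m 1%N) s a.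
  elim: m => [//|m IH] _ s a; have [->|m0] := eqVneq m 0%N.
    rewrite h1 /low /theta_low ge_min; apply/orP; left.
    exact: (bigmin_le _ (s, a) (fun sa : S * A => centered theta11 sa.1 sa.2)).
  have m1 : (1 <= m)%N by rewrite lt0n.
  by rewrite hnext//; apply: inner => //; [exact: IH | rewrite leqnn andbT].
by move=> n1 kr; apply: inner => //; exact: start.
Qed.

Lemma run_ge_cmin n k s a : (1 <= n)%N -> (1 <= k <= K.+1)%N ->
  c_min M lam piref theta11 Ssum <= softmax (theta n k) s a.
Proof.
by move=> n1 kr; apply: softmax_ge_of_centered => b; exact: centered_ge_low.
Qed.

Lemma c_min_gt0 (a : A) : 0 < c_min M lam piref theta11 Ssum.
Proof.
rewrite invr_gt0 ltr_pwDl// mulr_ge0 ?expR_ge0// subr_ge0 ler1n.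
by apply/card_gt0P; exists a.
Qed.

End Run.

(** * Geometric decrease of the suboptimality gap *)

Lemma small_step_exists (R : realType) (A : finType) (lam L Am el eh : R) :
  0 < lam -> 0 <= L -> 0 <= Am -> 0 < el -> 0 < eh ->
  exists y0, 0 < y0 /\
    forall y, 0 <= y <= y0 -> small_step A lam L Am el eh y.
Proof.
move=> lam0 L0 Am0 el0 eh0.
have E0 : 0 < expR (-1 : R) by exact: expR_gt0.
have N0 : 0 <= #|A|%:R :> R by exact: ler0n.
have EL0 : 0 <= lam * (expR (-1) + 2 * L) by apply: mulr_ge0; lra.
have NEL0 : 0 <= #|A|%:R * (expR (-1) + L) by apply: mulr_ge0; lra.
have H0 : 0 <= grad_bound lam L Am by rewrite /grad_bound; lra.
have NEL1 : 0 <= lam * (4 + 4 * #|A|%:R * (expR (-1) + L)).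
  by apply: mulr_ge0; lra.
have C10 : 0 <= grad_lip A lam L Am by rewrite /grad_lip; lra.
have NH0 : 0 <= #|A|%:R * grad_bound lam L Am by rewrite mulr_ge0.
have C20 : 0 <= grad_curv A lam L Am by rewrite /grad_curv; lra.
rewrite /small_step.
set C1 := grad_lip A lam L Am in C10 *; set H := grad_bound lam L Am in H0 *.
set C2 := grad_curv A lam L Am in C20 *.
have NC : 0 <= 4 * #|A|%:R * C1 by rewrite !mulr_ge0.
pose D := 2 * C1 + 8 * H + (4 * #|A|%:R * C1 + 8 * C2) + 1.
have D0 : 0 < D by rewrite /D; lra.
pose m := Num.min 1 (Num.min el eh).
have m0 : 0 < m by rewrite !lt_min ltr01 el0 eh0.
have m1 : m <= 1 by rewrite ge_min lexx.
have mel : m <= el by rewrite !ge_min lexx orbT.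
have meh : m <= eh by rewrite !ge_min lexx !orbT.
exists (m / D); split; first by rewrite divr_gt0.
move=> y /andP[y0 yD].
have yX X : 0 <= X -> X <= D -> y * X <= m.
  move=> X0 XD; apply: le_trans (_ : m / D * D <= _); first by rewrite ler_pM.
  by rewrite divfK// gt_eqF.
have b1 : y * (2 * C1) <= m by apply: yX; rewrite /D; lra.
have b2 : y * (8 * H) <= m by apply: yX; rewrite /D; lra.
have b3 : y * (4 * #|A|%:R * C1 + 8 * C2) <= m by apply: yX; rewrite /D; lra.
by split; [|split|]; lra.
Qed.

Section OuterStep.
Variables (R : realType) (S A : finType) (M : mdp R S A).
Variables (lam : R) (piref : S -> A -> R) (u : S -> R) (el eh : R) (K : nat).
Hypotheses (lam_gt0 : 0 < lam) (piref_policy : is_policy piref).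
Hypothesis c_ref_gt0 : 0 < c_ref piref.
Hypotheses (u_dist : is_dist u) (u_gt0 : forall s, 0 < u s).
Variable pistar : S -> A -> R.
Hypothesis pistar_policy : is_policy pistar.
Variables (theta11 : S -> A -> R) (eta : nat -> nat -> R).
Variables (theta : nat -> nat -> S -> A -> R) (Ssum cu cm y0 : R).
Hypotheses (cu_gt0 : 0 < cu) (cu_le : forall s, cu <= u s).
Hypothesis eta_ge0 : forall n k, (1 <= n)%N -> (1 <= k <= K)%N -> 0 <= eta n k.
Hypothesis eta_sum : forall n, (1 <= n)%N -> \sum_(1 <= k < K.+1) eta n k = Ssum.
Hypothesis run : ppo_run M lam piref u el eh K theta11 eta theta.
Hypothesis cm_gt0 : 0 < cm.
Hypothesis cm_le : forall n s a, (1 <= n)%N -> cm <= softmax (theta n 1%N) s a.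
Hypothesis small : forall y, 0 <= y <= y0 ->
  small_step A lam (L_ref piref) (A_max M lam piref) el eh y.
Hypotheses (Ssum_ge0 : 0 <= Ssum) (Ssum_le : Ssum <= (1 - gamma M) * y0).

Let g_gt0 : 0 < 1 - gamma M.
Proof. by case/andP: (gamma_bound M) => _; rewrite subr_gt0. Qed.

Let pol th : is_policy (softmax th : S -> A -> R).
Proof. exact: softmax_policy piref_policy _. Qed.

Let pref0 s a : 0 < piref s a. Proof. exact: piref_gt0. Qed.

Lemma ratio_norm_ge (d : S -> R) s : d s <= ratio_norm d u * u s.
Proof.
rewrite -ler_pdivrMr//; exact: (le_bigmax _ (fun s => d s / u s) s).
Qed.

Lemma ratio_norm_occ_gt0 : 0 < ratio_norm (occupancy M u pistar) u.
Proof.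
have [s _] := dist_inhabited u_dist.
rewrite -(pmulr_lgt0 _ (u_gt0 s)).
apply: lt_le_trans (ratio_norm_ge (occupancy M u pistar) s).
apply: lt_le_trans (occupancy_ge M s u_dist pistar_policy).
by rewrite mulr_gt0.
Qed.

Section OneStep.
Variable n : nat.
Hypothesis n_ge1 : (1 <= n)%N.

Let p := softmax (theta n 1%N).
Let p' := softmax (theta n.+1 1%N).
Let adv s a := advantage M lam piref p s a.
Let gain (q : S -> A -> R) s := \sum_a q s a * adv s a
  - lam * kl (q s) (piref s) + lam * kl (p s) (piref s).
Let sqadv s := \sum_a reg_adv lam (piref s) (adv s) (p s) a ^+ 2.

Let occ_bound s : 0 <= occupancy M u p s <= 1.
Proof.
have hd := occupancy_dist M u_dist (pol (theta n 1%N)).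
by rewrite (proj1 hd) dist_le1.
Qed.

(* The inner loop gain at [s], with the occupancy bounded below by
   [(1 - gamma) * u s] and the probabilities by [cm]. *)
Let gain_ge s : u s * Ssum / 2 * (cm ^+ 2 * sqadv s) <= gain p' s.
Proof.
have [a0 _] := dist_inhabited (piref_policy s).
have [_ hstep hnext] := run.
pose w := occupancy M u p s / (1 - gamma M).
have /andP[ o0 o1] := occ_bound s.
have w0 : 0 <= w by rewrite divr_ge0// ltW.
have wu : u s <= w.
  by rewrite ler_pdivlMr// mulrC; exact (occupancy_ge M s u_dist (pol _)).
have wy : 0 <= w * Ssum <= y0.
  rewrite mulr_ge0//= /w mulrAC ler_pdivrMr// mulrC [leRHS]mulrC.
  apply: le_trans Ssum_le; rewrite mulrC -[leRHS]mul1r; exact: ler_wpM2r.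
have hx k : (1 <= k <= K)%N -> forall a, theta n k.+1 s a = theta n k s a +
   eta n k * (w * logit_grad lam (piref s) (fun b =>
      clip_deriv el eh (adv s b) (smx (theta n k s) b / smx (theta n 1%N s) b))
      (smx (theta n k s)) a).
  move=> kr a; rewrite hstep//; congr (_ + _ * _).
  by apply: surrogate_gradE => // s' a'; exact: smx_gt0.
have hA a : `|adv s a| <= A_max M lam piref.
  exact: (advantage_bound M lam_gt0 piref_policy pref0 s a (pol (theta n 1%N))).
have adv0 : \sum_a smx (theta n 1%N s) a * adv s a = 0.
  exact: (advantage_mean0 M lam piref s (pol (theta n 1%N))).
have := @inner_loop_gain R A lam (piref s) (L_ref piref) (A_max M lam piref) el eh
  lam_gt0 (piref_policy s) (pref0 s) (L_ref_bound piref s) (adv s)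
  (fun k => theta n k s) (eta n) w K a0 hA adv0 w0 (fun k => @eta_ge0 n k n_ge1) hx.
rewrite /= (eta_sum n_ge1) => /(_ (small wy)) h.
have -> : gain p' s = \sum_a smx (theta n K.+1 s) a * adv s a -
   lam * kl (smx (theta n K.+1 s)) (piref s) +
   lam * kl (smx (theta n 1%N s)) (piref s) by rewrite /gain /p' hnext.
apply: le_trans h; apply: ler_pM.
- by rewrite divr_ge0// mulr_ge0// ltW.
- by rewrite mulr_ge0 ?sqr_ge0// sumr_ge0// => a _; exact: sqr_ge0.
- by rewrite ler_pM2r// ler_wpM2r.
rewrite mulr_sumr; apply: ler_sum => a _; rewrite /logit_grad exprMn.
apply: ler_wpM2r; first exact: sqr_ge0.
have h1 := cm_le s a n_ge1; rewrite lerXn2r ?nnegrE//; first exact: ltW.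
by rewrite ltW// smx_gt0.
Qed.

Let Q := \sum_s u s * sqadv s.

Let sqadv_ge0 s : 0 <= sqadv s.
Proof. by apply: sumr_ge0 => a _; exact: sqr_ge0. Qed.

(* The value increases by a multiple of the squared regularized advantages. *)
Let improvement : Ssum * cu * cm ^+ 2 / 2 * Q <=
  value M lam piref u p' - value M lam piref u p.
Proof.
rewrite -(ler_pM2l g_gt0) (value_difference M lam piref)//; try exact: pol.
rewrite mulrA mulr_sumr; apply: ler_sum => s _; rewrite -/(gain p' s).
apply: le_trans (_ : (1 - gamma M) * u s * gain p' s <= _); last first.
  apply: ler_wpM2r; last exact (occupancy_ge M s u_dist (pol _)).
  apply: le_trans (gain_ge s); apply: mulr_ge0.
    by rewrite divr_ge0// mulr_ge0// ltW.
  by rewrite mulr_ge0// sqr_ge0.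
apply: le_trans (_ : (1 - gamma M) * u s * (u s * Ssum / 2 * (cm ^+ 2 * sqadv s)) <= _);
  last first.
  by apply: ler_wpM2l; [rewrite mulr_ge0// ltW | exact: gain_ge].
have -> : (1 - gamma M) * (Ssum * cu * cm ^+ 2 / 2) * (u s * sqadv s) =
  cu * ((1 - gamma M) * u s * Ssum / 2 * (cm ^+ 2 * sqadv s)) by ring.
have -> : (1 - gamma M) * u s * (u s * Ssum / 2 * (cm ^+ 2 * sqadv s)) =
  u s * ((1 - gamma M) * u s * Ssum / 2 * (cm ^+ 2 * sqadv s)) by ring.
apply: ler_wpM2r => //; apply: mulr_ge0; last by rewrite mulr_ge0// sqr_ge0.
have us := ltW (u_gt0 s).
by apply: divr_ge0 => //; apply: mulr_ge0 => //; apply: mulr_ge0 => //; exact: ltW.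
Qed.

(* Gradient domination at the level of values; the mismatch between the occupancy
   of [pistar] and [u] is absorbed by the density ratio. *)
Let domination : (1 - gamma M) *
    (value M lam piref u pistar - value M lam piref u p) <=
  ratio_norm (occupancy M u pistar) u * Q / (2 * lam).
Proof.
rewrite (value_difference M lam piref)//; last exact: pol.
rewrite -mulrA mulr_suml mulr_sumr; apply: ler_sum => s _; rewrite -/(gain pistar s).
have o0 := proj1 (occupancy_dist M u_dist pistar_policy) s.
apply: le_trans (_ : occupancy M u pistar s * (sqadv s / (2 * lam)) <= _).
  apply: ler_wpM2l => //.
  apply: reg_gain_le => //; [exact: pol | by move=> a; exact: smx_gt0 |].
  exact: (advantage_mean0 M lam piref s (pol (theta n 1%N))).
rewrite -[X in _ <= _ * X]mulrA [leRHS]mulrA; apply: ler_wpM2r.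
  by rewrite divr_ge0// mulr_ge0// ltW.
exact: ratio_norm_ge.
Qed.

(** One outer iteration contracts the suboptimality gap. *)
Lemma gap_step :
  value M lam piref u pistar - value M lam piref u (softmax (theta n.+1 1%N)) <=
  (1 - (1 - gamma M) * lam * cu * cm ^+ 2 *
     (ratio_norm (occupancy M u pistar) u)^-1 * Ssum) *
  (value M lam piref u pistar - value M lam piref u (softmax (theta n 1%N))).
Proof.
have r0 := ratio_norm_occ_gt0; have := domination; have := improvement.
rewrite -/p -/p'; set r := ratio_norm _ _ in r0 *.
set V := value _ _ _ _ p; set V' := value _ _ _ _ p'; set W := value _ _ _ _ pistar.
move=> himp hdom.
have c0 : 0 <= lam * cu * cm ^+ 2 * r^-1 * Ssum.
  by rewrite !mulr_ge0 ?invr_ge0 ?sqr_ge0// ltW.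
have := ler_wpM2l c0 hdom.
have -> : lam * cu * cm ^+ 2 * r^-1 * Ssum * (r * Q / (2 * lam)) =
   Ssum * cu * cm ^+ 2 / 2 * Q.
  by field; rewrite !gt_eqF.
have -> : lam * cu * cm ^+ 2 * r^-1 * Ssum * ((1 - gamma M) * (W - V)) =
  (1 - gamma M) * lam * cu * cm ^+ 2 * r^-1 * Ssum * (W - V) by ring.
rewrite mulrBl mul1r => h; lra.
Qed.

End OneStep.

Lemma gap_geometric n : (1 <= n)%N ->
  let beta := (1 - gamma M) * lam * cu * cm ^+ 2 *
                (ratio_norm (occupancy M u pistar) u)^-1 in
  (forall m, (1 <= m)%N ->
    0 <= value M lam piref u pistar - value M lam piref u (softmax (theta m 1%N))) ->
  value M lam piref u pistar - value M lam piref u (softmax (theta n 1%N)) <=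
  (value M lam piref u pistar - value M lam piref u (softmax (theta 1%N 1%N))) *
  expR (- (beta * Ssum * (n%:R - 1))).
Proof.
move=> n1 beta gap0; elim: n n1 => [//|n IH] _.
have [->|n0] := eqVneq n 0%N; first by rewrite subrr mulr0 oppr0 expR0 mulr1.
have n1 : (1 <= n)%N by rewrite lt0n.
apply: le_trans (gap_step n1) _; rewrite -/beta.
apply: le_trans (_ : expR (- (beta * Ssum)) * (value M lam piref u pistar -
   value M lam piref u (softmax (theta n 1%N))) <= _).
  by apply: ler_wpM2r; [exact: gap0 | exact: expR_ge1Dx].
apply: le_trans (ler_wpM2l (expR_ge0 _) (IH n1)) _.
rewrite mulrCA -expRD le_eqVlt; apply/orP; left; apply/eqP.
by congr (_ * expR _); rewrite -natr1; ring.
Qed.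

End OuterStep.

(** * Convergence of the algorithm *)

Theorem theorem4p7 (R : realType) (S A : finType) (M : mdp R S A)
    (lam : R) (piref : S -> A -> R) (u : S -> R) (el eh : R) (K : nat)
    (lam_gt0 : 0 < lam)
    (piref_policy : is_policy piref)
    (c_ref_gt0 : 0 < c_ref piref)
    (u_dist : is_dist u)
    (u_gt0 : forall s, 0 < u s)
    (el_bound : 0 < el < 1) (eh_gt0 : 0 < eh)
    (K_gt0 : (0 < K)%N) :
  exists pistar : S -> A -> R,
    [/\ is_optimal M lam piref pistar,
        forall pi, is_optimal M lam piref pi -> pi = pistar
      & exists Sbar : R, 0 < Sbar /\
        forall (cu : R) (theta11 : S -> A -> R) (eta : nat -> nat -> R)
               (theta : nat -> nat -> S -> A -> R) (Ssum : R),
          0 < cu -> (forall s, cu <= u s) ->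
          (forall n k, (1 <= n)%N -> (1 <= k <= K)%N -> 0 <= eta n k) ->
          (forall n, (1 <= n)%N -> \sum_(1 <= k < K.+1) eta n k = Ssum) ->
          ppo_run M lam piref u el eh K theta11 eta theta ->
          0 < Ssum <= Sbar ->
          let pi := fun n k => softmax (theta n k) in
          let cmin := c_min M lam piref theta11 Ssum in
          let beta := (1 - gamma M) * lam * cu * cmin ^+ 2 *
                      (ratio_norm (occupancy M u pistar) u)^-1 in
          let gap := value M lam piref u pistar
                     - value M lam piref u (pi 1%N 1%N) in
          [/\ cmin <= inf [set x : R | exists n k s a,
                       [/\ (1 <= n)%N, (1 <= k <= K)%N & x = pi n k s a]]
                /\ 0 < cmin,
              forall rho : S -> R, is_dist rho -> forall n, (1 <= n)%N ->
                value M lam piref rho pistar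
                  - value M lam piref rho (pi n 1%N)
                <= gap / (cu * (1 - gamma M))
                   * expR (- (beta * Ssum * (n%:R - 1))),
              forall n, (1 <= n)%N ->
                \sum_s \sum_a (pi n 1%N s a - pistar s a) ^+ 2
                <= 2 * gap / (lam * cu) * expR (- (beta * Ssum * (n%:R - 1)))
            & converges_linearly (fun n => pi n.+1 1%N) pistar]].
Proof.
have pref0 s a : 0 < piref s a by exact: piref_gt0.
have g0 : 0 < 1 - gamma M.
  by case/andP: (gamma_bound M) => _; rewrite subr_gt0.
have [s0 _] := dist_inhabited u_dist.
have [a0 _] := dist_inhabited (piref_policy s0).
have [pistar [pstar_pol pstar_gt0 subopt]] :=
  @soft_optimal_exists R S A M lam piref lam_gt0 piref_policy pref0.
have kl0 pi s : is_policy pi -> 0 <= kl (pi s) (pistar s).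
  by move=> Hp; exact: kl_ge0.
(* Strong convexity turns a value gap into a squared distance between policies. *)
have dist_le pi cu : is_policy pi -> 0 < cu -> (forall s, cu <= u s) ->
    lam * cu / 2 * sqdist pi pistar <=
    value M lam piref u pistar - value M lam piref u pi.
  move=> Hp cu0 hcu; rewrite -(ler_pM2l g0) subopt//.
  rewrite /sqdist mulrA !mulr_sumr; apply: ler_sum => s _.
  have h1 := kl_ge_sqdist (Hp s) (pstar_pol s) (pstar_gt0 s).
  have h2 := occupancy_ge M s u_dist Hp.
  have h3 : (1 - gamma M) * cu <= occupancy M u pi s.
    by apply: le_trans h2; rewrite ler_pM2l.
  set D := \sum_a _ in h1 *.
  have D0 : 0 <= D by apply: sumr_ge0 => a _; exact: sqr_ge0.
  have -> : (1 - gamma M) * (lam * cu / 2) * D =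
    lam * ((1 - gamma M) * cu * (D / 2)) by field.
  rewrite ler_pM2l// ler_pM//; last by rewrite divr_ge0.
  by rewrite mulr_ge0// ltW.
have value_le rho pi : is_dist rho -> is_policy pi ->
    value M lam piref rho pi <= value M lam piref rho pistar.
  move=> Hr Hp; rewrite -subr_ge0 -(pmulr_rge0 _ g0) subopt//.
  apply: mulr_ge0; first exact: ltW.
  apply: sumr_ge0 => s _; apply: mulr_ge0; last exact: kl0.
  exact: (proj1 (occupancy_dist M Hr Hp)).
have pstar_opt : is_optimal M lam piref pistar.
  by split=> // pi Hp s; apply: value_le => //; exact: dirac_dist_dist.
exists pistar; split=> //.
  move=> pi [Hp Ho].
  have uV : value M lam piref u pi = value M lam piref u pistar.
    rewrite !valueE//; apply: eq_bigr => s _; congr (_ * _); apply/eqP.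
    by rewrite eq_le Ho// andbT; apply: (proj2 pstar_opt).
  (* Any positive lower bound of [u] serves here; the neutral element 1 does no harm. *)
  pose cu := \big[Num.min/1]_s u s.
  have cu0 : 0 < cu by apply/bigmin_gtP; split.
  have cul s : cu <= u s by exact: bigmin_le.
  have := dist_le pi cu Hp cu0 cul; rewrite uV subrr => hd.
  have sq0 : sqdist pi pistar <= 0.
    by move: hd; rewrite pmulr_rle0// divr_gt0// mulr_gt0.
  have sum0 s : \sum_a (pi s a - pistar s a) ^+ 2 <= 0.
    apply: le_trans sq0; rewrite /sqdist (bigD1 s)//= lerDl sumr_ge0// => s' _.
    by apply: sumr_ge0 => a _; exact: sqr_ge0.
  apply/funext => s; apply/funext => a; apply/eqP.
  rewrite -subr_eq0 -sqrf_eq0 eq_le sqr_ge0 andbT (le_trans _ (sum0 s))//.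
  by rewrite (bigD1 a)//= lerDl sumr_ge0// => b _; exact: sqr_ge0.
case/andP: el_bound => el0 el1.
have [y0 [y00 small]] := @small_step_exists R A lam (L_ref piref)
  (A_max M lam piref) el eh lam_gt0 (L_ref_ge0 piref)
  (A_max_ge0 M lam_gt0 piref_policy pref0 s0 a0) el0 eh_gt0.
exists ((1 - gamma M) * y0); split; first by rewrite mulr_gt0.
move=> cu theta11 eta theta Ssum cu0 hcu eta0 etaS run /andP[S0 S1] pi cmin beta gap.
have pol n k : is_policy (pi n k) by exact: softmax_policy piref_policy _.
have cmin0 : 0 < cmin by exact: c_min_gt0.
have cmin_le n k s a : (1 <= n)%N -> (1 <= k <= K.+1)%N -> cmin <= pi n k s a.
  by move=> n1 kr; apply: (run_ge_cmin lam_gt0 piref_policy c_ref_gt0 u_dist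
    eta0 etaS run).
have gap_ge0 rho n : is_dist rho ->
    0 <= value M lam piref rho pistar - value M lam piref rho (pi n 1%N).
  by move=> Hr; rewrite subr_ge0; exact: value_le.
have geo n : (1 <= n)%N ->
    value M lam piref u pistar - value M lam piref u (pi n 1%N) <=
    gap * expR (- (beta * Ssum * (n%:R - 1))).
  move=> n1; apply: (gap_geometric lam_gt0 piref_policy c_ref_gt0 u_dist u_gt0
    pstar_pol cu0 hcu eta0 etaS run cmin0 _ small (ltW S0) S1 n1).
    by move=> m s a m1; exact: cmin_le.
  by move=> m _; exact: gap_ge0.
have E0 x : 0 <= expR x :> R by exact: expR_ge0.
have gap0 : 0 <= gap by exact: gap_ge0.
have sq_bound n : (1 <= n)%N -> sqdist (pi n 1%N) pistar <=
    2 * gap / (lam * cu) * expR (- (beta * Ssum * (n%:R - 1))).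
  move=> n1; have := le_trans (dist_le _ cu (pol n 1%N) cu0 hcu) (geo n n1).
  have lc : 0 < lam * cu / 2 by rewrite divr_gt0// mulr_gt0.
  rewrite -ler_pdivlMl// => h; apply: le_trans h _.
  rewrite le_eqVlt; apply/orP; left; apply/eqP.
  by field; rewrite !gt_eqF.
split.
- split=> //; apply: lb_le_inf.
    exists (pi 1%N 1%N s0 a0), 1%N, 1%N, s0, a0; split=> //.
  move=> x [n [k [s [a [n1 /andP[k1 kK] ->]]]]].
  by apply: cmin_le; rewrite ?k1 ?leqW.
- move=> rho rho_dist n n1.
  apply: le_trans (_ : cu^-1 * (value M lam piref u pistar -
      value M lam piref u (pi n 1%N)) <= _).
    rewrite !valueE// -!sumrB mulr_sumr; apply: ler_sum => s _.
    rewrite -!mulrBr.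
    set x := state_value _ _ _ pistar s - _.
    have x0 : 0 <= x by apply: (gap_ge0 _ n); exact: dirac_dist_dist.
    rewrite mulrA; apply: ler_wpM2r => //.
    apply: le_trans (dist_le1 s rho_dist) _.
    by rewrite mulrC ler_pdivlMr// mul1r.
  apply: le_trans (_ : cu^-1 * (gap * expR (- (beta * Ssum * (n%:R - 1)))) <= _).
    by rewrite ler_pM2l ?invr_gt0//; exact: geo.
  rewrite mulrA; apply: ler_wpM2r => //.
  rewrite mulrC; apply: ler_wpM2l => //.
  rewrite lef_pV2 ?posrE ?mulr_gt0// -[leRHS]mulr1 ler_pM2l//.
  by rewrite lerBlDr lerDl; case/andP: (gamma_bound M).
- by move=> n n1; exact: sq_bound.
- have beta0 : 0 < beta.
    rewrite /beta !mulr_gt0 ?exprn_gt0// invr_gt0.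
    exact: (ratio_norm_occ_gt0 M u_dist u_gt0 pstar_pol).
  pose q := expR (- (beta * Ssum / 2)); pose C := Num.sqrt (2 * gap / (lam * cu)).
  have c0 : 0 <= 2 * gap / (lam * cu).
    by rewrite divr_ge0 ?mulr_ge0// ltW// mulr_gt0.
  exists C, q; split; first exact: sqrtr_ge0.
    rewrite expR_ge0/= -[ltRHS]expR0 ltr_expR oppr_lt0.
    by rewrite divr_gt0// mulr_gt0.
  move=> n; have qn0 : 0 <= q ^+ n by rewrite exprn_ge0// expR_ge0.
  have -> : C * q ^+ n = Num.sqrt (2 * gap / (lam * cu) * (q ^+ n) ^+ 2).
    by rewrite sqrtrM// sqrtr_sqr ger0_norm.
  rewrite ler_wsqrtr//; apply: le_trans (sq_bound n.+1 isT) _.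
  rewrite -exprM -expRM_natl le_eqVlt; apply/orP; left; apply/eqP.
  by congr (_ * expR _); rewrite -natr1 natrM; field.
Qed.
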